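(* Let $0<\alpha<1$, $T>0$, let $\Omega\subset\mathbb{R}^n$ be a bounded domain with smooth boundary $\partial\Omega$, let $a_{ij}=a_{ji}\in C^1(\overline{\Omega})$ ($1\le i,j\le n$) be functions for which there is a constant $\mu_0>0$ with $\sum_{i,j=1}^n a_{ij}(x)\xi_i\xi_j\ge\mu_0\sum_{i=1}^n\xi_i^2$ for all $x\in\overline{\Omega}$ and $\xi_1,\dots,\xi_n\in\mathbb{R}$, and let $c\in C(\overline{\Omega})$ (with no restriction on its sign). Let $a\in L^2(\Omega)$ and $F\in L^2(\Omega\times(0,T))$, and let $u_{a,F}$ denote the weak solution on $\Omega\times(0,T)$ of $$\partial_t^\alpha u(x,t)=\sum_{i,j=1}^n\partial_i(a_{ij}(x)\partial_j u(x,t))+c(x)u(x,t)+F(x,t),\quad x\in\Omega,\ t>0,$$ $$u(x,t)=0,\quad x\in\partial\Omega,\ t>0,\qquad u(x,0)=a(x),\quad x\in\Omega.$$ If $F(x,t)\ge 0$ a.e. in $\Omega\times(0,T)$ and $a(x)\ge 0$ a.e. in $\Omega$, then $u_{a,F}(x,t)\ge 0$ a.e. in $\Omega\times(0,T)$.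
   Context: Fractional derivative. For $u\in C^1[0,T]$ the Caputo derivative of order $\alpha\in(0,1)$ is $\partial_t^\alpha u(t)=\frac{1}{\Gamma(1-\alpha)}\int_0^t(t-s)^{-\alpha}\frac{du}{ds}(s)\,ds$. In earlier work (Gorenflo, Luchko and Yamamoto) it was extended to an operator defined on $H_\alpha(0,T)$, the closure of $\{u\in C^1[0,T]:u(0)=0\}$ in the fractional Sobolev space $H^\alpha(0,T)$; $\partial_t^\alpha$ in the equation is this extension, with domain $H_\alpha(0,T)$, and is applied to $u-a$, where $a$ is regarded as constant in $t$. Weak solution. The initial-boundary-value problem is interpreted as the fractional diffusion equation subject to the inclusions $u(\cdot,t)\in H^1_0(\Omega)$ for $t>0$ and $u(x,\cdot)-a(x)\in H_\alpha(0,T)$ for $x\in\Omega$, which encode the boundary and initial conditions. It is taken from that earlier work that for every $a\in L^2(\Omega)$ and $F\in L^2(\Omega\times(0,T))$ there is a unique weak solution $u_{a,F}\in L^2(0,T;H^2(\Omega)\cap H^1_0(\Omega))\cap H^\alpha(0,T;L^2(\Omega))$ of the equation subject to these inclusions. *)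

(* Defs.v *)
From HB Require Import structures.
From mathcomp Require Import all_boot all_order all_algebra.
From mathcomp Require Import all_classical all_reals all_analysis.

Set Implicit Arguments.
Unset Strict Implicit.
Unset Printing Implicit Defensive.
Import Order.TTheory GRing.Theory Num.Theory.
Import numFieldNormedType.Exports.
Local Open Scope classical_set_scope.
Local Open Scope ring_scope.

Definition rV_display : measure_display -> measure_display.
Proof. exact. Qed.

Section measurable_rV.
Variables (R : realType) (n : nat).

Definition rV_coord (i : 'I_n) (x : 'rV[R]_n) : R := x ord0 i.

Let rV_set0 : g_sigma_preimage rV_coord set0.
Proof. exact: sigma_algebra0. Qed.

Let rV_setC A : g_sigma_preimage rV_coord A -> g_sigma_preimage rV_coord (~` A).
Proof. exact: sigma_algebraC. Qed.

Let rV_bigcup (F : (set 'rV[R]_n)^nat) :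
  (forall i, g_sigma_preimage rV_coord (F i)) ->
  g_sigma_preimage rV_coord (\bigcup_i (F i)).
Proof. exact: sigma_algebra_bigcup. Qed.

HB.instance Definition _ :=
  @isMeasurable.Build (rV_display default_measure_display)
    'rV[R]_n (g_sigma_preimage rV_coord) rV_set0 rV_setC rV_bigcup.

End measurable_rV.


Section lebesgue_rV.
Variable R : realType.

Lemma measurable_rV_coord n (i : 'I_n) :
  measurable_fun [set: 'rV[R]_n] (@rV_coord R n i).
Proof.
move=> _ Y mY; rewrite setTI; apply: sub_sigma_algebra => /=.
rewrite -bigcup_seq/=; exists i => /=; first by rewrite mem_index_enum.
by exists Y => //; rewrite setTI.
Qed.

Lemma measurable_fun_rV d (T : measurableType d) n (f : T -> 'rV[R]_n) :
  (forall i, measurable_fun [set: T] (@rV_coord R n i \o f)) ->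
  measurable_fun [set: T] f.
Proof.
move=> mf; suff h : g_sigma_preimage (fun i => @rV_coord R n i \o f) `<=`
    measurable.
  rewrite g_sigma_preimage_comp in h.
  by move=> _ A mA; apply: h; exists A.
apply: smallest_sub; first exact: sigma_algebra_measurable.
case: n => [|n] in f mf *; first by rewrite big_ord0.
rewrite -bigcup_mkord_ord; apply: bigcup_sub => i Ii.
by move=> A [B mB <-]; exact: mf.
Qed.

Definition rV_cons n (z : measurableTypeR R * 'rV[R]_n) : 'rV[R]_n.+1 :=
  \row_i oapp (fun j => z.2 ord0 j) z.1 (unlift ord0 i).

Definition rV_uncons n (x : 'rV[R]_n.+1) : measurableTypeR R * 'rV[R]_n :=
  (x ord0 ord0, \row_j x ord0 (lift ord0 j)).

Lemma rV_consK n : cancel (@rV_cons n) (@rV_uncons n).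
Proof.
move=> [t v]; rewrite /rV_uncons /rV_cons; congr pair.
  by rewrite mxE unlift_none.
by apply/rowP => j; rewrite !mxE liftK.
Qed.

Lemma measurable_rV_cons n : measurable_fun setT (@rV_cons n).
Proof.
apply: measurable_fun_rV => i; case: (unliftP ord0 i) => [j ->|->].
  rewrite (_ : _ \o _ = @rV_coord R n j \o snd).
    by apply: measurableT_comp => //; exact: measurable_rV_coord.
  by apply/funext => z /=; rewrite /rV_coord mxE liftK.
rewrite (_ : _ \o _ = fst) ; first exact: measurable_fst.
by apply/funext => z /=; rewrite /rV_coord mxE unlift_none.
Qed.

Lemma measurable_rV_uncons n : measurable_fun setT (@rV_uncons n).
Proof.
apply: measurable_fun_pair; first exact: measurable_rV_coord.
apply: measurable_fun_rV => i.
rewrite (_ : _ \o _ = @rV_coord R n.+1 (lift ord0 i)).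
  exact: measurable_rV_coord.
by apply/funext => x /=; rewrite /rV_coord mxE.
Qed.

Section step.
Variables (n : nat) (m : {sigma_finite_measure set 'rV[R]_n -> \bar R}).

Definition lebesgue_rVS : set 'rV[R]_n.+1 -> \bar R :=
  pushforward (@lebesgue_measure R \x m)%E (@rV_cons n).

Let lebesgue_rVS0 : lebesgue_rVS set0 = 0%E.
Proof. by rewrite /lebesgue_rVS /pushforward preimage_set0 measure0. Qed.

Let lebesgue_rVS_ge0 A : (0 <= lebesgue_rVS A)%E.
Proof. exact: (measure_ge0 (lebesgue_measure \x m)%E). Qed.

Let lebesgue_rVS_sigma_additive : semi_sigma_additive lebesgue_rVS.
Proof.
move=> F mF tF mUF; rewrite /lebesgue_rVS /pushforward preimage_bigcup.
have mC A : measurable A -> measurable (@rV_cons n @^-1` A).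
  by move=> mA; rewrite -[X in measurable X]setTI; exact: measurable_rV_cons.
apply: measure_semi_sigma_additive => [k||]; first exact: mC.
- apply/trivIsetP => /= i j _ _ ij; rewrite -preimage_setI.
  by move/trivIsetP : tF => /(_ _ _ _ _ ij) ->//; rewrite preimage_set0.
- by rewrite -preimage_bigcup; exact: mC.
Qed.

HB.instance Definition _ := isMeasure.Build _ _ _ lebesgue_rVS
  lebesgue_rVS0 lebesgue_rVS_ge0 lebesgue_rVS_sigma_additive.

Let lebesgue_rVS_sigma_finite : sigma_finite setT lebesgue_rVS.
Proof.
have /sigma_finiteP[F [FT ndF Foo]] := sigma_finiteT (@lebesgue_measure R).
have /sigma_finiteP[G [GT ndG Goo]] := sigma_finiteT m.
exists (fun k => @rV_uncons n @^-1` (F k `*` G k)).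
  rewrite -preimage_bigcup (_ : \bigcup_i _ = setT) ?preimage_setT//.
  rewrite -setXTT FT GT predeqE => -[x y]; split.
    by move=> [k _ []/= ? ?]; split; exists k.
  move=> [/= [i _ Fix] [k _ Gky]]; exists (maxn i k) => //; split.
  - by move: x Fix; exact/subsetPset/ndF/leq_maxl.
  - by move: y Gky; exact/subsetPset/ndG/leq_maxr.
move=> k; have [mF Fk] := Foo k; have [mG Gk] := Goo k; split.
  rewrite -[X in measurable X]setTI; apply: measurable_rV_uncons => //.
  exact: measurableX.
rewrite /lebesgue_rVS /pushforward -comp_preimage (_ : _ \o _ = id).
  by rewrite preimage_id product_measure1E// lte_mul_pinfty// ge0_fin_numE.
by apply/funext => z /=; rewrite rV_consK.
Qed.

HB.instance Definition _ := Measure_isSigmaFinite.Build _ _ _ lebesgue_rVS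
  lebesgue_rVS_sigma_finite.

End step.

(* n-dimensional Lebesgue measure, as the n-fold product of the Lebesgue
   measure on R; the measure on the one-point space R^0 is the unit mass. *)
Fixpoint lebesgue_rV n : {sigma_finite_measure set 'rV[R]_n -> \bar R} :=
  match n with
  | 0 => [the {sigma_finite_measure set 'rV[R]_0 -> \bar R} of
            @dirac _ 'rV[R]_0 0 R]
  | n'.+1 => [the {sigma_finite_measure set 'rV[R]_n'.+1 -> \bar R} of
                lebesgue_rVS (lebesgue_rV n')]
  end.

Lemma lebesgue_rV_box n (A : 'I_n -> set R) :
  (forall i, measurable (A i)) ->
  lebesgue_rV n [set x : 'rV[R]_n | forall i, A i (x ord0 i)] =
  (\prod_(i < n) lebesgue_measure (A i))%E.
Proof.
elim: n A => [|n IH] A mA.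
  rewrite big_ord0 /= diracE (_ : 0 \in _)// inE => -[]; by [].
rewrite big_ord_recl -(IH (fun i => A (lift ord0 i)))//.
set B := [set x : 'rV[R]_n | forall i, A (lift ord0 i) (x ord0 i)].
have mB : measurable B.
  rewrite (_ : B = \bigcap_(i in [set: 'I_n])
      (@rV_coord R n i @^-1` A (lift ord0 i))); last first.
    by apply/seteqP; split => x /= h i //=; exact: h.
  apply: fin_bigcap_measurable => // i _.
  by rewrite -[X in measurable X]setTI; exact: measurable_rV_coord.
transitivity ((@lebesgue_measure R \x lebesgue_rV n)%E (A ord0 `*` B)).
  congr (product_measure1 _ _ _).
  apply/seteqP; split => -[t v] /=.
    move=> h; split; first by have := h ord0; rewrite mxE unlift_none.
    by move=> i; have := h (lift ord0 i); rewrite mxE liftK.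
  move=> [h0 h] i; case: (unliftP ord0 i) => [j ->|->]; rewrite mxE.
    by rewrite liftK; exact: h.
  by rewrite unlift_none.
rewrite product_measure1E; [by []|exact: mA|exact: mB].
Qed.

End lebesgue_rV.

Section L2.
Context (R : realType) d (X : measurableType d) (mu : {measure set X -> \bar R}).
Implicit Types (D : set X) (f : X -> R).

Definition L2 D f : Prop := f \_ D \in Lfun mu 2%:E.

Definition L2_cvg D (f_ : nat -> X -> R) f : Prop :=
  ('N[mu]_2%:E[EFin \o ((f_ k \- f)%R \_ D)])%E @[k --> \oo] --> 0%E.

End L2.

Section domains_and_coefficients.
Variables (R : realType) (n : nat).
Implicit Types (f : 'rV[R]_n -> R) (U Omega : set 'rV[R]_n).

Definition partial (i : 'I_n) f : 'rV[R]_n -> R :=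
  fun x => 'D_(delta_mx ord0 i) f x.

(* C^oo on an open set U: for every multi-index, written as the list s of the
   successive directions, the iterated partial derivative exists on U and is
   continuous there. *)
Definition smooth_on U f : Prop :=
  forall (s : seq 'I_n) x, U x ->
    {for x, continuous (foldr partial f s)} /\
    (forall i, derivable (foldr partial f s) x (delta_mx ord0 i)).

(* C^oo_c(Omega), each function being extended by 0 outside Omega *)
Definition test_function Omega f : Prop :=
  smooth_on [set: 'rV[R]_n] f /\
  exists K, [/\ compact K, K `<=` Omega & forall x, ~ K x -> f x = 0].

Definition bounded_domain Omega : Prop :=
  [/\ open Omega, connected Omega, Omega !=set0 & bounded_set Omega].

(* Near each boundary point, Omega is the sublevel set {rho < 0} of a C^oo
   function rho whose gradient does not vanish at that point. *)
Definition smooth_boundary Omega : Prop :=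
  forall x, (closure Omega `&` closure (~` Omega)) x ->
  exists (U : set 'rV[R]_n) (rho : 'rV[R]_n -> R),
    [/\ open_nbhs x U, smooth_on U rho, exists i, partial i rho x != 0,
        rho x = 0 & U `&` Omega = U `&` [set y | rho y < 0]].

Definition C0_closure Omega f : Prop := {within closure Omega, continuous f}.

(* C^1 of the closure of Omega: continuous on the closure, and with partial
   derivatives in Omega that extend continuously to the closure. *)
Definition C1_closure Omega f : Prop :=
  C0_closure Omega f /\
  forall i, (forall x, Omega x -> derivable f x (delta_mx ord0 i)) /\
    exists2 g, C0_closure Omega g & forall x, Omega x -> partial i f x = g x.

Definition weak_partial Omega (i : 'I_n) f g : Prop :=
  forall phi, test_function Omega phi ->
    \int[lebesgue_rV R n]_(x in Omega) (f x * partial i phi x) =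
    - \int[lebesgue_rV R n]_(x in Omega) (g x * phi x).

(* f belongs to H^1_0(Omega), the closure of C^oo_c(Omega) in H^1(Omega), and
   its weak gradient is (g i)_i. *)
Definition H1_0 Omega f (g : 'I_n -> 'rV[R]_n -> R) : Prop :=
  [/\ L2 (lebesgue_rV R n) Omega f,
      forall i, L2 (lebesgue_rV R n) Omega (g i) /\ weak_partial Omega i f (g i) &
      exists phi_ : nat -> 'rV[R]_n -> R,
        [/\ forall k, test_function Omega (phi_ k),
            L2_cvg (lebesgue_rV R n) Omega phi_ f &
            forall i, L2_cvg (lebesgue_rV R n) Omega
                        (fun k => partial i (phi_ k)) (g i)]].

End domains_and_coefficients.

Section fractional_derivative.
Variable R : realType.
Implicit Types (alpha T : R) (v w : R -> R).
Local Notation leb := (@lebesgue_measure R).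

Definition Gamma (z : R) : R :=
  \int[leb]_(s in `]0, +oo[) (s `^ (z - 1) * expR (- s)).

Definition caputo alpha v (t : R) : R :=
  (Gamma (1 - alpha))^-1 *
  \int[leb]_(s in `]0, t[) ((t - s) `^ (- alpha) * derive1 v s).

Definition C1_itv T v : Prop :=
  {within `[0, T], continuous v} /\
  (forall t, t \in `]0, T[ -> derivable v t 1) /\
  exists2 dv : R -> R, {within `[0, T], continuous dv} &
    forall t, t \in `]0, T[ -> derive1 v t = dv t.

Definition slobodeckij alpha T v : \bar R :=
  (\int[leb \x leb]_(z in `]0%R, T[ `*` `]0%R, T[)
     ((v z.1 - v z.2) ^+ 2 / `|z.1 - z.2| `^ (1 + 2 * alpha))%:E)%E.

Definition Halpha alpha T v : Prop :=
  L2 leb `]0, T[ v /\ (slobodeckij alpha T v < +oo)%E.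

Definition Halpha_cvg alpha T (v_ : nat -> R -> R) v : Prop :=
  L2_cvg leb `]0, T[ v_ v /\
  slobodeckij alpha T (v_ k \- v) @[k --> \oo] --> 0%E.

(* the closure in H^alpha(0,T) of the C^1 functions on [0,T] vanishing at 0 *)
Definition Halpha0 alpha T v : Prop :=
  Halpha alpha T v /\
  exists v_ : nat -> R -> R,
    (forall k, C1_itv T (v_ k) /\ v_ k 0 = 0) /\ Halpha_cvg alpha T v_ v.

(* "the extended Caputo derivative of v is w": the extension by closure of
   [caputo alpha], from the C^1 functions vanishing at 0, to H_alpha(0,T), with
   values in L^2(0,T).  For alpha != 1/2 the operator is bounded from H^alpha
   to L^2, so every v in [Halpha0] has such a w.  For alpha = 1/2 the closure
   of those functions in the norm of H^(1/2) is the whole of H^(1/2), where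
   the operator is only closable; the graph closure is then defined on the
   smaller Lions-Magenes space, which is the H_(1/2)(0,T) of Gorenflo, Luchko
   and Yamamoto. *)
Definition caputo_ext alpha T v w : Prop :=
  [/\ Halpha alpha T v, L2 leb `]0, T[ w &
      exists v_ : nat -> R -> R,
        [/\ forall k, C1_itv T (v_ k) /\ v_ k 0 = 0,
            Halpha_cvg alpha T v_ v &
            L2_cvg leb `]0, T[ (fun k => caputo alpha (v_ k)) w]].

End fractional_derivative.

Section weak_solution.
Variables (R : realType) (n : nat).
Local Notation leb := (@lebesgue_measure R).
Local Notation lebn := (lebesgue_rV R n).

Definition cylinder (Omega : set 'rV[R]_n) (T : R) : set ('rV[R]_n * R) :=
  Omega `*` `]0, T[.

(* finiteness of the seminorm of H^alpha(0,T; L^2(Omega)) *)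
Definition Halpha_L2 (alpha T : R) (Omega : set 'rV[R]_n)
    (u : 'rV[R]_n * R -> R) : Prop :=
  (\int[leb \x leb]_(z in `]0%R, T[ `*` `]0%R, T[)
     ((\int[lebn]_(x in Omega) ((u (x, z.1) - u (x, z.2)) ^+ 2)%:E) *
      ((`|z.1 - z.2| `^ (1 + 2 * alpha))^-1)%:E) < +oo)%E.

(* u is the weak solution, on Omega x (0,T), of
     d_t^alpha (u - a) = sum_(i, j) d_i (A i j d_j u) + c u + F
   in the class L^2(0,T; H^2 cap H^1_0) cap H^alpha(0,T; L^2).  In a Bochner
   space L^2(0,T; Y) with Y a space of functions on Omega, elements are jointly
   measurable representatives.  Here Du i and D2u i j are the weak derivatives
   d_i u and d_i d_j u, and P i j is the weak derivative d_i (A i j d_j u). *)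
Definition weak_solution (alpha T : R) (Omega : set 'rV[R]_n)
    (A : 'I_n -> 'I_n -> 'rV[R]_n -> R) (c a : 'rV[R]_n -> R)
    (F u : 'rV[R]_n * R -> R) : Prop :=
  let L2Q := L2 (lebn \x leb)%E (cylinder Omega T) in
  exists (Du : 'I_n -> 'rV[R]_n * R -> R)
         (D2u P : 'I_n -> 'I_n -> 'rV[R]_n * R -> R),
  [/\ L2Q u /\ Halpha_L2 alpha T Omega u,
      forall i, L2Q (Du i) /\ forall j, L2Q (D2u i j) /\ L2Q (P i j),
      {ae leb, forall t, t \in `]0, T[ ->
        H1_0 Omega (fun x => u (x, t)) (fun i x => Du i (x, t)) /\
        forall i j,
          weak_partial Omega i (fun x => Du j (x, t))
                               (fun x => D2u i j (x, t)) /\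
          weak_partial Omega i (fun x => A i j x * Du j (x, t))
                               (fun x => P i j (x, t))} &
      {ae lebn, forall x, Omega x ->
        Halpha0 alpha T (fun t => u (x, t) - a x) /\
        caputo_ext alpha T (fun t => u (x, t) - a x)
          (fun t => \sum_i \sum_j P i j (x, t) + c x * u (x, t) + F (x, t))}].

End weak_solution.

(* Main.v *)
Require Import Defs.
From HB Require Import structures.
From mathcomp Require Import all_boot all_order all_algebra.
From mathcomp Require Import all_classical all_reals all_analysis.
From mathcomp Require Import measurable_realfun.
From mathcomp Require Import ring lra.

Set Implicit Arguments.
Unset Strict Implicit.
Unset Printing Implicit Defensive.
Import Order.TTheory GRing.Theory Num.Theory.
Import numFieldNormedType.Exports.
Local Open Scope classical_set_scope.
Local Open Scope ring_scope.

(** Let p = max (- u) 0 be the negative part of u.  The equation is tested with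
    exp (- lam t) p, which gives three terms.

    Space.  Formally the integral of div (A grad u) p over Omega equals that of
    A (grad p) . (grad p), since grad p = - grad u where u < 0, so it is
    nonnegative.  For a weak solution the divergence may only be tested with
    smooth compactly supported functions.  As u (., t) is a limit in H^1 of such
    functions phi_k, the test functions are psi (phi_k), where psi is a smooth
    approximation of the negative part that vanishes at 0
    ([elliptic_smooth_neg], [elliptic_negpart]).

    Time.  For almost every x the function v = u (x, .) - a x satisfies, with
    p = max (- (v + a)) 0 and a >= 0,

      int_0^T exp (- lam t) p (- d_t^alpha v) dt
        >= kappa int_0^T exp (- lam t) p^2 dt,
      kappa = delta^(- alpha) (1 - exp (- lam delta)) / (2 Gamma (1 - alpha)),

    for all lam, delta > 0 ([caputo_C1_lower_bound] for C^1 functions,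
    [caputo_ext_lower_bound] for the extended derivative).  The reason is that up
    to sign d_t^alpha v superposes backward differences v (t - theta) - v t: write
    the kernel (t - s)^(- alpha) as the measure of the levels y below it;
    for a fixed level the s-integral of the derivative of v runs over an interval
    of length theta = y^(- 1 / alpha), cut at time 0.  Extended by 0 to negative
    times, v + a equals a >= 0 there, so p vanishes.  By convexity of p^2
    ([negpart_convex]), p t (v (t - theta) - v t) is at least
    (p t^2 - p (t - theta)^2) / 2, and the exponential weight turns the
    integrated difference into a gain of the factor (1 - exp (- lam theta)) / 2
    ([caputo_step]).  The levels y < delta^(- alpha) are those with
    theta > delta, whence kappa.

    Conclusion.  In - p d_t^alpha v = - p div (A grad u) - p c u - p F the last
    term is nonpositive and - p c u = c p^2 is at most C p^2, C = sup |c|.  Integrating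
    the time bound over Omega and the space bound over ]0, T[ leaves
    kappa I <= C I, where I is the integral of exp (- lam t) p^2 over the
    cylinder.  For lam = 1 / delta and delta small kappa exceeds C
    ([exists_large_rate]), so I = 0 and u >= 0 almost everywhere. *)

(** * Square-integrable functions *)

Section square_integrable.
Context (R : realType) d (X : measurableType d) (mu : {measure set X -> \bar R}).
Implicit Types (D : set X) (f g : X -> R) (fk gk : nat -> X -> R).

Definition sqintegrable D f : Prop :=
  measurable_fun D f /\ mu.-integrable D (fun x => (f x ^+ 2)%:E).

(** Convergence in L^2 is phrased with the square of the norm, so that a
    comparison of integrands compares the two sides directly. *)
Definition sqcvg D (fk : nat -> X -> R) f : Prop :=
  (\int[mu]_(x in D) ((fk k x - f x) ^+ 2)%:E)%E @[k --> \oo] --> 0%E.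

Lemma L2_sqintegrable D f : measurable D -> L2 mu D f -> sqintegrable D f.
Proof.
move=> mD; rewrite /L2 => /andP[].
rewrite !inE/= => mf; rewrite /finite_norm => fin.
have mfD : measurable_fun D f by apply/measurable_restrictT.
split => //; apply/integrableP; split.
  by apply/measurable_EFinP; exact: measurable_funX.
have -> : (\int[mu]_(x in D) `|(f x ^+ 2)%:E| =
    'N[mu]_2%:E [EFin \o f \_ D] `^ 2)%E.
  rewrite poweR_Lnorm ?pnatr_eq0//.
  rewrite integral_mkcond; apply: eq_integral => x _ /=.
  rewrite /patch; case: ifPn => _ /=; rewrite powR_mulrn ?normr_ge0//.
    by rewrite normrX.
  by rewrite normr0 expr0n.
by apply: poweR_lty.
Qed.

Lemma L2_cvg_sqcvg D fk f : L2_cvg mu D fk f -> sqcvg D fk f.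
Proof.
rewrite /L2_cvg /sqcvg; set N := (X in X @ _ --> _) => h.
rewrite [X in X @ _ --> _](_ : _ = fun k => (N k * N k)%E); last first.
  apply/funext => k.
  have sqE (z : \bar R) : (0 <= z -> z * z = z `^ 2)%E.
    move: z => [r| |]//= r0; rewrite ?mulyy ?gt_eqF//.
    by rewrite -EFinM /= powR_mulrn// expr2.
  rewrite sqE; last exact: Lnorm_ge0.
  rewrite /N poweR_Lnorm ?pnatr_eq0// integral_mkcond.
  apply: eq_integral => x _ /=.
  rewrite /patch; case: ifPn => _ /=; rewrite powR_mulrn ?normr_ge0//.
    by rewrite -normrX ger0_norm// sqr_ge0.
  by rewrite normr0 expr0n.
have d00 : ((0 : \bar R) *? 0)%E by [].
have hNN : (N k * N k)%E @[k --> \oo] --> (0 * 0)%E.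
  exact: (@cvgeM _ _ _ _ N N _ _ d00 h h).
by rewrite mule0 in hNN.
Qed.

Lemma sqintegrable_mul D f g : measurable D ->
  sqintegrable D f -> sqintegrable D g -> mu.-integrable D (fun x => (f x * g x)%:E).
Proof.
move=> mD [mf if2] [mg ig2].
have := integrableD mD if2 ig2; apply: le_integrable => //.
  by apply/measurable_EFinP; exact: measurable_funM.
move=> x _; rewrite -[X in (_ <= `|X|)%E]/((f x ^+ 2 + g x ^+ 2)%:E) lee_fin.
rewrite (ger0_norm (addr_ge0 _ _)) ?sqr_ge0//.
rewrite normrM -(real_normK (num_real (f x))) -(real_normK (num_real (g x))).
by set a := `|f x|; set b := `|g x|; nra.
Qed.

Lemma sqintegrableD D f g : measurable D ->
  sqintegrable D f -> sqintegrable D g -> sqintegrable D (fun x => f x + g x).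
Proof.
move=> mD Lf Lg; have ifg := sqintegrable_mul mD Lf Lg.
case: Lf Lg => mf if2 [mg ig2]; split; first exact: measurable_funD.
have := integrableD mD (integrableD mD if2 ig2) (integrableZl mD 2 ifg).
by apply: eq_integrable => // x _ /=; rewrite -!EFinD; congr EFin; ring.
Qed.

Lemma sqintegrableM D f g (C : R) : measurable D -> measurable_fun D g ->
  (forall x, D x -> `|g x| <= C) ->
  sqintegrable D f -> sqintegrable D (fun x => g x * f x).
Proof.
move=> mD mg gC [mf if2]; split; first exact: measurable_funM.
have := integrableZl mD (C ^+ 2) if2; apply: le_integrable => //.
  by apply/measurable_EFinP; apply: measurable_funX; exact: measurable_funM.
move=> x Dx; rewrite -EFinM !abse_EFin lee_fin.
rewrite [leRHS]ger0_norm; last by apply: mulr_ge0; exact: sqr_ge0.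
rewrite ger0_norm ?sqr_ge0// exprMn.
rewrite -(real_normK (num_real (g x))).
rewrite ler_wpM2r ?sqr_ge0//.
have := gC _ Dx; have := normr_ge0 (g x).
by set a := `|g x|; nra.
Qed.

Lemma sqintegrableN D f : measurable D ->
  sqintegrable D f -> sqintegrable D (fun x => - f x).
Proof.
move=> mD [mf if2]; split; first exact: measurableT_comp.
by under eq_fun do rewrite sqrrN.
Qed.

Lemma sqintegrableB D f g : measurable D ->
  sqintegrable D f -> sqintegrable D g -> sqintegrable D (fun x => f x - g x).
Proof. by move=> mD Lf Lg; apply: sqintegrableD => //; exact: sqintegrableN. Qed.

Lemma sqintegrable_sum D (I : Type) (s : seq I) (f : I -> X -> R) : measurable D ->
  (forall i, sqintegrable D (f i)) -> sqintegrable D (fun x => \sum_(i <- s) f i x).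
Proof.
move=> mD Lf; elim: s => [|i s IH].
  under eq_fun do rewrite big_nil; split => //.
  under eq_fun do rewrite expr0n; exact: integrable0.
by under eq_fun do rewrite big_cons; exact: sqintegrableD.
Qed.

Lemma sqintegrable_bounded D f (C : R) : measurable D -> (mu D < +oo)%E ->
  measurable_fun D f -> (forall x, D x -> `|f x| <= C) -> sqintegrable D f.
Proof.
move=> mD Doo mf fC; split => //.
apply: measurable_bounded_integrable => //; first exact: measurable_funX.
exists (C ^+ 2); split; first exact: num_real.
move=> M CM x Dx /=; rewrite normrX (le_trans _ (ltW CM))//.
have := fC _ Dx; have := normr_ge0 (f x).
by set a := `|f x|; nra.
Qed.

Lemma sqintegrable_le D f g : measurable D -> measurable_fun D f ->
  (forall x, D x -> `|f x| <= `|g x|) -> sqintegrable D g -> sqintegrable D f.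
Proof.
move=> mD mf fg [mg ig2]; split => //; apply: le_integrable ig2 => //.
  by apply/measurable_EFinP; exact: measurable_funX.
move=> x Dx /=; rewrite lee_fin !normrX; have := fg _ Dx; have := normr_ge0 (f x).
by set a := `|f x|; set b := `|g x|; nra.
Qed.

(** This is how convergence passes through the Lipschitz maps used below:
    truncation, weights bounded by one and the negative part. *)
Lemma sqcvg_le D fk f gk g (C : R) : measurable D -> 0 <= C ->
  (forall k, measurable_fun D (fk k)) -> measurable_fun D f ->
  (forall k, measurable_fun D (gk k)) -> measurable_fun D g ->
  (forall k x, D x -> `|gk k x - g x| <= C * `|fk k x - f x|) ->
  sqcvg D fk f -> sqcvg D gk g.
Proof.
move=> mD C0 mfk mf mgk mg gf cf.
apply: (@squeeze_cvge _ _ _ _ (cst 0%E) _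
  (fun k => (C ^+ 2)%:E * \int[mu]_(x in D) ((fk k x - f x) ^+ 2)%:E)%E).
- apply: nearW => k; apply/andP; split.
    by apply: integral_ge0 => x _; rewrite lee_fin sqr_ge0.
  rewrite -ge0_integralZl//; last 3 first.
  + by apply/measurable_EFinP; apply: measurable_funX; exact: measurable_funB.
  + by move=> x _; rewrite lee_fin sqr_ge0.
  + by rewrite lee_fin sqr_ge0.
  apply: ge0_le_integral => //.
  + by move=> x _; rewrite lee_fin sqr_ge0.
  + by apply/measurable_EFinP; apply: measurable_funX; exact: measurable_funB.
  + apply/measurable_EFinP; apply: measurable_funM => //.
    by apply: measurable_funX; exact: measurable_funB.
  + move=> x Dx; rewrite -EFinM lee_fin -exprMn.
    rewrite -(real_normK (num_real (gk k x - g x))).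
    rewrite -[leRHS](real_normK (num_real _)) normrM (ger0_norm C0).
    by rewrite ler_sqr ?nnegrE ?mulr_ge0//; exact: gf.
- exact: cvg_cst.
- by rewrite -(mule0 (C ^+ 2)%:E); apply: cvgeZl.
Qed.

(** Young's inequality with a small parameter e takes the place of
    Cauchy-Schwarz: the error is at most (1 + 1 / e) times the squared L^2
    distances plus e times a constant, and e is fixed before k. *)
Lemma cvg_Rintegral_mul D fk f gk g : measurable D ->
  (forall k, sqintegrable D (fk k)) -> sqintegrable D f -> sqcvg D fk f ->
  (forall k, sqintegrable D (gk k)) -> sqintegrable D g -> sqcvg D gk g ->
  \int[mu]_(x in D) (fk k x * gk k x) @[k --> \oo] -->
  \int[mu]_(x in D) (f x * g x).
Proof.
move=> mD Lfk Lf cf Lgk Lg cg.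
pose A k := \int[mu]_(x in D) ((fk k x - f x) ^+ 2).
pose B k := \int[mu]_(x in D) ((gk k x - g x) ^+ 2).
pose M := \int[mu]_(x in D) (f x ^+ 2) + \int[mu]_(x in D) (g x ^+ 2).
have M0 : 0 <= M by rewrite addr_ge0// Rintegral_ge0// => x _; exact: sqr_ge0.
have cA : A k @[k --> \oo] --> 0 by apply: (@fine_cvg _ _ _ _ _ 0).
have cB : B k @[k --> \oo] --> 0 by apply: (@fine_cvg _ _ _ _ _ 0).
have bnd (e : R) k : 0 < e ->
    `|\int[mu]_(x in D) (f x * g x) - \int[mu]_(x in D) (fk k x * gk k x)| <=
    (1 + e^-1) * (A k + B k) + e * M.
  move=> e0.
  have LfB := sqintegrableB mD (Lfk k) Lf.
  have LgB := sqintegrableB mD (Lgk k) Lg.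
  have i1 := sqintegrable_mul mD Lf Lg.
  have i2 := sqintegrable_mul mD (Lfk k) (Lgk k).
  rewrite -RintegralB//.
  apply: le_trans (le_normr_Rintegral _ _) _ => //; first exact: (integrableB mD i1 i2).
  have i3 := integrableD mD LfB.2 LgB.2.
  have i3' := integrableZl mD (1 + e^-1) i3.
  have i4 := integrableD mD Lf.2 Lg.2.
  have i4' := integrableZl mD e i4.
  rewrite /A /B /M -!RintegralD//; [|exact: Lf.2|exact: Lg.2|exact: LfB.2|exact: LgB.2].
  rewrite -!RintegralZl// -?RintegralD//.
  apply: le_Rintegral => //.
  - exact: (integrable_abse (integrableB mD i1 i2)).
  - exact: (integrableD mD i3' i4').
  move=> x Dx.
  set p := f x; set q := g x; set p' := fk k x; set q' := gk k x.
  have -> : p * q - p' * q' = - ((p' - p) * (q' - q) + (p' - p) * q + p * (q' - q)) by ring.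
  rewrite normrN.
  have key (y z : R) : `|y * z| <= e^-1 * y ^+ 2 + e * z ^+ 2.
    rewrite normrM -(real_normK (num_real y)) -(real_normK (num_real z)).
    have := normr_ge0 y; have := normr_ge0 z.
    move: `|y| `|z| => {}y {}z z0 y0.
    have -> : e^-1 * y ^+ 2 + e * z ^+ 2 =
       e^-1 * (y - e * z) ^+ 2 + 2 * (y * z).
      by field; rewrite gt_eqF.
    have : 0 <= e^-1 * (y - e * z) ^+ 2 by rewrite mulr_ge0 ?sqr_ge0// invr_ge0 ltW.
    have : 0 <= y * z by rewrite mulr_ge0.
    lra.
  have k1 := key (p' - p) q.
  have k2 := key (q' - q) p.
  have k3 : `|(p' - p) * (q' - q)| <= (p' - p) ^+ 2 + (q' - q) ^+ 2.
    rewrite normrM -(real_normK (num_real (p' - p))) -(real_normK (num_real (q' - q))).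
    have := normr_ge0 (p' - p); have := normr_ge0 (q' - q).
    by move: `|p' - p| `|q' - q| => y z y0 z0; nra.
  rewrite [p * _]mulrC.
  apply: (le_trans (ler_normD _ _)); apply: (le_trans (lerD (ler_normD _ _) (lexx _))).
  have ? : 0 <= e * p ^+ 2 by rewrite mulr_ge0 ?sqr_ge0// ltW.
  nra.
apply/cvgrPdist_le => /= e e0.
(* h is the parameter of Young's inequality that makes h * M at most e / 2 *)
pose h := e / 2 / (M + 1).
have h0 : 0 < h by rewrite !divr_gt0// ltr_wpDl.
have hM : h * M <= e / 2.
  rewrite /h -mulrA ler_piMr//; first lra.
  by rewrite ler_pdivrMl ?mulr1 ?ltr_wpDl//; lra.
have cAB : (1 + h^-1) * (A k + B k) @[k --> \oo] --> 0.
  have -> : (0 : R) = (1 + h^-1) * (0 + 0) by rewrite addr0 mulr0.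
  by apply: cvgM; [exact: cvg_cst|exact: cvgD].
have e20 : 0 < e / 2 by lra.
move/cvgrPdist_le : cAB => /(_ _ e20); apply: filterS => k; rewrite sub0r normrN => hk.
apply: (le_trans (bnd _ k h0)).
by have := ler_norm ((1 + h^-1) * (A k + B k)); lra.
Qed.

Lemma integrable_sumr D (I : Type) (s : seq I) (f : I -> X -> R) : measurable D ->
  (forall i, mu.-integrable D (fun x => (f i x)%:E)) ->
  mu.-integrable D (fun x => (\sum_(i <- s) f i x)%:E).
Proof.
move=> mD fi; elim: s => [|i s IH].
  by under eq_fun do rewrite big_nil; exact: integrable0.
under eq_fun do rewrite big_cons EFinD.
by apply: integrableD => //; exact: IH.
Qed.

Lemma integrable_scaler D (k : R) f : measurable D ->
  mu.-integrable D (EFin \o f) -> mu.-integrable D (EFin \o (fun x => k * f x)).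
Proof.
move=> mD fi; rewrite (_ : _ \o _ = fun x => (k%:E * (EFin \o f) x)%E).
  exact: integrableZl.
by apply/funext => x /=; rewrite EFinM.
Qed.

Lemma integrable_subr D f g : measurable D ->
  mu.-integrable D (EFin \o f) -> mu.-integrable D (EFin \o g) ->
  mu.-integrable D (EFin \o (fun x => f x - g x)).
Proof.
move=> mD fi gi; rewrite (_ : _ \o _ = ((EFin \o f) \- (EFin \o g))%E).
  exact: integrableB.
by apply/funext => x /=; rewrite EFinB.
Qed.

Lemma Rintegral_sum D (I : Type) (s : seq I) (f : I -> X -> R) : measurable D ->
  (forall i, mu.-integrable D (fun x => (f i x)%:E)) ->
  \int[mu]_(x in D) (\sum_(i <- s) f i x) = \sum_(i <- s) \int[mu]_(x in D) f i x.
Proof.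
move=> mD fi; elim: s => [|i s IH].
  rewrite big_nil; under eq_Rintegral do rewrite big_nil.
  by rewrite /Rintegral integral0.
rewrite big_cons -IH -RintegralD//; [|exact: fi|exact: integrable_sumr].
by apply: eq_Rintegral => x _; rewrite big_cons.
Qed.

End square_integrable.

(** * Borel sets of row vectors *)

Lemma compact_continuous_bounded (R : realType) (X : topologicalType) (K : set X)
    (f : X -> R) : compact K -> {within K, continuous f} ->
  exists2 C, 0 <= C & forall x, K x -> `|f x| <= C.
Proof.
move=> cK cf; have := continuous_compact cf cK.
move=> /compact_bounded [M [_ /(_ (`|M| + 1))]].
have M1 : M < `|M| + 1 by rewrite (le_lt_trans (ler_norm _))// ltrDl.
move=> /(_ M1) h; exists (`|M| + 1); first by rewrite addr_ge0.
by move=> x Kx; apply: h; exists x.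
Qed.

Section borel_rV.
Variables (R : realType) (n : nat).
Implicit Types (U D : set 'rV[R]_n) (f : 'rV[R]_n -> R).

Lemma measurable_rV_cube (A : 'I_n -> set R) : (forall i, measurable (A i)) ->
  measurable [set x : 'rV[R]_n | forall i, A i (x ord0 i)].
Proof.
move=> mA.
rewrite (_ : [set x | _] = \bigcap_(i in [set: 'I_n]) (@rV_coord R n i @^-1` A i)); last first.
  by apply/seteqP; split => x /= h i //=; exact: h.
apply: fin_bigcap_measurable => // i _.
by rewrite -[X in measurable X]setTI; exact: measurable_rV_coord.
Qed.

(** The sigma-algebra of row vectors is generated by the coordinates and the
    topology by cubes, so an open set has to be written as a countable union of
    cubes: those with rational centre and radius 1 / (k + 1) that it contains. *)
Lemma open_measurable_rV U : open U -> measurable U.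
Proof.
move=> oU.
pose r (k : nat) : R := k.+1%:R^-1.
pose B (p : 'rV[rat]_n * nat) := [set y : 'rV[R]_n |
  forall i, `]ratr (p.1 ord0 i) - r p.2, ratr (p.1 ord0 i) + r p.2[%classic (y ord0 i)].
rewrite (_ : U = \bigcup_(k in [set: nat])
    (if unpickle k is Some p then (if `[< B p `<=` U >] then B p else set0)
     else set0)); last first.
  apply/seteqP; split => [x Ux|x [k _]]; last first.
    by case: unpickle => [p|//]; case: asboolP => // BU; exact: BU.
  have /nbhs_ballP[e /= e0 eU] : nbhs x U by exact: open_nbhs_nbhs.
  have e20 : 0 < e / 2 by rewrite divr_gt0.
  have /ltr_add_invr[k ke] : 0 < e / 2 := e20.
  rewrite add0r -/(r k) in ke.
  have k0 : 0 < r k by rewrite invr_gt0.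
  have ex (i : 'I_n) : exists q : rat, `|ratr q - x ord0 i| < r k.
    have /rat_in_itvoo[q] : x ord0 i - r k < x ord0 i + r k by lra.
    rewrite in_itv/= => /andP[q1 q2]; exists q; rewrite ltr_norml; lra.
  pose c := \row_i (xchoose (ex i)).
  have hc i : `|ratr (c ord0 i) - x ord0 i| < r k.
    by rewrite mxE; exact: (xchooseP (ex i)).
  exists (pickle (c, k)) => //; rewrite pickleK.
  case: asboolP => [_ i|].
    by have := hc i; rewrite ltr_norml /= in_itv/=; lra.
  case; move=> y By; apply: eU; split => // i j; rewrite (ord1 i).
  have := By j; have := hc j; rewrite /ball/= in_itv/= !ltr_norml.
  lra.
apply: bigcup_measurable => k _; case: unpickle => // p.
case: asboolP => // _.
apply: (@measurable_rV_cube (fun i =>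
  `]ratr (p.1 ord0 i) - r p.2, ratr (p.1 ord0 i) + r p.2[%classic)) => i.
exact: measurable_itv.
Qed.

Lemma open_continuous_measurable_fun_rV U f : open U ->
  (forall x, U x -> {for x, continuous f}) -> measurable_fun U f.
Proof.
move=> oU cf; apply: (measurability _ (RGenOpens.measurableE R)).
move=> _ [_ [a [b ->] <-]]; apply: open_measurable_rV.
rewrite openE => x [Ux fx]; rewrite /interior.
apply: filterI; first exact: open_nbhs_nbhs.
by apply: (cf x Ux); apply: open_nbhs_nbhs; split => //; exact: interval_open.
Qed.

Lemma C0_closure_measurable U f : open U -> C0_closure U f -> measurable_fun U f.
Proof.
move=> oU cf; apply: open_continuous_measurable_fun_rV => //.
have : {within U, continuous f}.
  by apply: (continuous_subspaceW _ cf); exact: subset_closure.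
by rewrite continuous_open_subspace// => h x Ux; apply: h; rewrite inE.
Qed.

Lemma C0_closure_bounded U f : bounded_set U -> C0_closure U f ->
  exists C, forall x, U x -> `|f x| <= C.
Proof.
move=> bU cf.
have cU : compact (closure U).
  apply: bounded_closed_compact; last exact: closed_closure.
  have [M [Mr hM]] := bU; exists (`|M| + 1); split => // N MN x.
  suff : closure U `<=` closed_ball_ Num.norm 0 N.
    by move=> /[apply]; rewrite /closed_ball_/= sub0r normrN.
  rewrite closureE; apply: smallest_sub; first exact: closed_closed_ball_.
  move=> y Uy; rewrite /closed_ball_/= sub0r normrN; apply: hM Uy.
  by rewrite (le_lt_trans (ler_norm _))// (lt_trans _ MN)// ltrDl.
have [C _ fC] := compact_continuous_bounded cU cf.
by exists C => x Ux; apply: fC; exact: subset_closure.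
Qed.

Lemma bounded_lebesgue_rV_lty U : open U -> bounded_set U -> (lebesgue_rV R n U < +oo)%E.
Proof.
move=> oU [M [_ /(_ (`|M| + 1))]].
have M1 : M < `|M| + 1 by rewrite (le_lt_trans (ler_norm _))// ltrDl.
move=> /(_ M1); set C := `|M| + 1 => hC.
have C0 : 0 <= C by rewrite /C addr_ge0.
apply: (@le_lt_trans _ _ (lebesgue_rV R n
  [set x : 'rV[R]_n | forall i, `[- C, C]%classic (x ord0 i)])).
  apply: le_measure; rewrite ?inE.
  - exact: open_measurable_rV.
  - by apply: (@measurable_rV_cube (fun=> `[- C, C]%classic)) => i; exact: measurable_itv.
  - move=> x /hC /= xC i /=; rewrite in_itv/= -ler_norml.
    apply: le_trans xC; rewrite [leRHS]mx_normrE.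
    exact: (le_bigmax _ (fun ij : 'I_1 * 'I_n => `|x ij.1 ij.2|) (ord0, i)).
rewrite (lebesgue_rV_box (A := fun=> `[- C, C]%classic))//.
suff : (\prod_(i < n) (@lebesgue_measure R) `[(- C)%R, C])%E \is a fin_num.
  by rewrite fin_numE => /andP[_]; rewrite -ltey.
apply: (big_ind (fun x : \bar R => x \is a fin_num)) => //.
- by move=> x y xoo yoo; rewrite fin_numM.
- by move=> i _; rewrite lebesgue_measure_itv/=; case: ifP.
Qed.

End borel_rV.

(** * The negative part *)

Section negative_part.
Variable R : realType.
Implicit Types y z : R.

Definition negpart y : R := Num.max (- y) 0.

Lemma negpart_ge0 y : 0 <= negpart y.
Proof. by rewrite /negpart le_max lexx orbT. Qed.

Lemma negpart_lip y z : `|negpart y - negpart z| <= `|y - z|.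
Proof.
rewrite /negpart; have [|] := leP (- y) 0; have [|] := leP (- z) 0 => hz hy;
  have [h|h] := leP 0 (y - z); rewrite ?(ger0_norm h) ?(ltr0_norm h) ?ler_norml; lra.
Qed.

Lemma negpart_le_norm y : `|negpart y| <= `|y|.
Proof.
have := negpart_lip y 0.
by rewrite (_ : negpart 0 = 0) ?subr0// /negpart oppr0 maxxx.
Qed.

Lemma continuous_negpart : continuous negpart.
Proof.
move=> y; apply/cvgrPdist_le => e e0; near=> z.
apply: le_trans (negpart_lip _ _) _.
by near: z; apply: cvgr_dist_le => //; exact: cvg_id.
Unshelve. all: by end_near. Qed.

Lemma measurable_negpart d (X : measurableType d) (D : set X) (f : X -> R) :
  measurable_fun D f -> measurable_fun D (fun x => negpart (f x)).
Proof.
move=> mf; apply: (measurableT_comp (f := negpart)) => //.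
exact: continuous_measurable_fun continuous_negpart.
Qed.

(** The tangent of z |-> negpart z ^+ 2 / 2 at y, whose slope is - negpart y,
    lies below that convex function. *)
Lemma negpart_convex y z :
  (negpart y ^+ 2 - negpart z ^+ 2) / 2 <= negpart y * (z - y).
Proof.
have := sqr_ge0 (y - z); have := sqr_ge0 z; have := sqr_ge0 y.
rewrite /negpart; have [hy|hy] := leP (- y) 0; have [hz|hz] := leP (- z) 0; nra.
Qed.

End negative_part.

(** * Smooth functions of several variables *)

Section smooth_calculus.
Variables (R : realType) (n : nat).
Implicit Types (f g : 'rV[R]_n -> R).

(** Only the derivative of f in the direction v is assumed, so the chain rule is
    the one-variable one applied along the line t |-> t v + x. *)
Lemma is_derive_comp1 (f : 'rV[R]_n -> R) (h : R -> R) x v dh :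
  derivable f x v -> is_derive (f x) 1 h dh ->
  is_derive x v (h \o f) (dh * 'D_v f x).
Proof.
move=> df dh1.
pose F (t : R) := f (t *: v + x).
have F0 : F 0 = f x by rewrite /F scale0r add0r.
have lineE (G : 'rV[R]_n -> R) : 'D_v G x = 'D_1 (fun t : R => G (t *: v + x)) 0.
  rewrite /derive; set g1 := fun h => h^-1 *: _; set g2 := fun h => h^-1 *: _.
  suff -> : g1 = g2 by [].
  by apply/funext => t; rewrite /g1 /g2 /= addr0 scale0r add0r [_%:A]mulr1.
have dF : is_derive (0 : R) 1 F ('D_v f x).
  split; first exact: (derivable1P f x v).1 df.
  exact: (esym (lineE f)).
rewrite -F0 in dh1.
have [dhF dhFE] := is_derive1_comp dh1 dF.
have hF : (fun t : R => (h \o f) (t *: v + x)) = h \o F by [].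
split; first by apply/derivable1P; rewrite hF.
by rewrite (lineE (h \o f)) hF.
Qed.

(** Here the first derivative is the innermost one, whereas [smooth_on] adds
    derivatives on the outside; this order makes products and composites
    amenable to induction on m. *)
Fixpoint Ck m f : Prop :=
  if m is m'.+1 then
    continuous f /\ forall i, (forall x, derivable f x (delta_mx ord0 i)) /\ Ck m' (partial i f)
  else continuous f.

Lemma Ck_continuous m f : Ck m f -> continuous f.
Proof. by case: m => [//|m []]. Qed.

Lemma CkS m f : Ck m.+1 f -> Ck m f.
Proof.
elim: m f => [|m IH] f; first by case.
by case=> cf df; split => // i; have [dfi /IH] := df i.
Qed.

Lemma foldr_partial_rcons f s i :
  foldr (@partial R n) f (rcons s i) = foldr (@partial R n) (partial i f) s.
Proof. by rewrite -cats1 foldr_cat. Qed.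

Lemma smooth_CkP f : smooth_on [set: 'rV[R]_n] f <-> forall m, Ck m f.
Proof.
split=> [sf m|Cf s].
  elim: m f sf => [|m IH] f sf; first by move=> x; exact: (sf [::] x I).1.
  split; first by move=> x; exact: (sf [::] x I).1.
  move=> i; split; first by move=> x; exact: (sf [::] x I).2.
  by apply: IH => s x _; rewrite -foldr_partial_rcons; exact: sf.
elim/last_ind: s f Cf => [|s i IH] f Cf x _.
  split; first exact: (Ck_continuous (Cf 0)).
  by move=> i; have [_ /(_ i)[]] := Cf 1%N.
rewrite foldr_partial_rcons; apply: IH => // m.
by have [_ /(_ i)[]] := Cf m.+1.
Qed.

Lemma Ck_cst m (a : R) : Ck m (fun=> a).
Proof.
elim: m a => [|m IH] a /=; first exact: cst_continuous.
split; first exact: cst_continuous.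
move=> i; split; first by move=> x; exact: derivable_cst.
rewrite (_ : partial i _ = fun=> 0); first exact: IH.
by apply/funext => x; rewrite /partial derive_cst.
Qed.

Lemma CkD m f g : Ck m f -> Ck m g -> Ck m (fun x => f x + g x).
Proof.
elim: m f g => [|m IH] f g /=.
  by move=> cf cg x; apply: continuousD; [exact: cf|exact: cg].
move=> [cf df] [cg dg]; split; first by move=> x; apply: continuousD; [exact: cf|exact: cg].
move=> i; have [df1 Cdf] := df i; have [dg1 Cdg] := dg i.
split; first by move=> x; exact: derivableD.
rewrite (_ : partial i _ = fun x => partial i f x + partial i g x); first exact: IH.
by apply/funext => x; rewrite /partial (deriveD (df1 x) (dg1 x)).
Qed.

Lemma CkM m f g : Ck m f -> Ck m g -> Ck m (fun x => f x * g x).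
Proof.
elim: m f g => [|m IH] f g; first by move=> cf cg x; apply: continuousM; [exact: cf|exact: cg].
move=> Cf Cg; have [cf df] := Cf; have [cg dg] := Cg.
split; first by move=> x; apply: continuousM; [exact: cf|exact: cg].
move=> i; have [df1 Cdf] := df i; have [dg1 Cdg] := dg i.
split; first by move=> x; exact: derivableM.
rewrite (_ : partial i _ = fun x => f x * partial i g x + g x * partial i f x).
  by apply: CkD; apply: IH => //; exact: CkS.
by apply/funext => x; rewrite /partial (deriveM (df1 x) (dg1 x)).
Qed.

(** Composition with h is one order more regular than composition with h': the
    step of an induction in which h' is a polynomial in the identity and in
    functions treated before. *)
Lemma Ck_compS m f (h h' : R -> R) :
  (forall y : R, is_derive y 1 h (h' y)) ->
  Ck m.+1 f -> Ck m (h' \o f) -> Ck m.+1 (h \o f).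
Proof.
move=> dh [cf df] Ch'; split.
  move=> x; apply: continuous_comp; first exact: cf.
  apply/differentiable_continuous/derivable1_diffP.
  by have [] := dh (f x).
move=> i; have [df1 Cdf] := df i; split.
  by move=> x; have [] := is_derive_comp1 (df1 x) (dh (f x)).
rewrite (_ : partial i _ = fun x => (h' \o f) x * partial i f x); first exact: CkM.
by apply/funext => x; have [_ <-] := is_derive_comp1 (df1 x) (dh (f x)).
Qed.

End smooth_calculus.

(** * A smooth approximation of the negative part *)

Section smooth_negpart.
Variables (R : realType) (e : R).
Hypothesis e0 : 0 < e.

Definition smooth_abs (y : R) : R := Num.sqrt (y ^+ 2 + e ^+ 2).

(** The shift by e makes the value at 0 vanish, so that composition with
    [smooth_neg] keeps a support compact. *)
Definition smooth_neg (y : R) : R := (smooth_abs y - y - e) / 2.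

Definition smooth_neg' (y : R) : R := (y * (smooth_abs y)^-1 - 1) / 2.

Lemma sqr_smooth_abs y : smooth_abs y ^+ 2 = y ^+ 2 + e ^+ 2.
Proof. by rewrite sqr_sqrtr// addr_ge0 ?sqr_ge0. Qed.

Lemma smooth_abs_gt0 y : 0 < smooth_abs y.
Proof. by rewrite sqrtr_gt0 ltr_wpDl ?sqr_ge0// exprn_gt0. Qed.

Lemma smooth_abs_ge_norm y : `|y| <= smooth_abs y.
Proof.
have := sqr_smooth_abs y; have := smooth_abs_gt0 y; rewrite ler_norml; set r := smooth_abs y => r0 r2.
by have := sqr_ge0 e; nra.
Qed.

Lemma is_derive_smooth_abs (y : R) : is_derive y 1 smooth_abs (y * (smooth_abs y)^-1).
Proof.
have s0 : 0 < y ^+ 2 + e ^+ 2 by rewrite ltr_wpDl ?sqr_ge0// exprn_gt0.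
have d1 : is_derive y 1 (fun y : R => y ^+ 2 + e ^+ 2) (2 * y).
  by apply: is_derive_eq; rewrite /GRing.scale/=; ring.
have d2 := is_derive1_sqrt s0.
suff : is_derive y 1 (Num.sqrt \o (fun y : R => y ^+ 2 + e ^+ 2)) (y * (smooth_abs y)^-1) by [].
have d3 := @is_derive1_comp _ Num.sqrt (fun y : R => y ^+ 2 + e ^+ 2) y _ _ d2 d1.
suff <- : (2 * Num.sqrt (y ^+ 2 + e ^+ 2))^-1 * (2 * y) = y * (smooth_abs y)^-1 by exact: d3.
rewrite -/(smooth_abs y); have := smooth_abs_gt0 y => r0; field; exact: lt0r_neq0.
Qed.

Lemma is_derive_smooth_absV (y : R) :
  is_derive y 1 (fun y => (smooth_abs y)^-1) (- y * (smooth_abs y)^-1 ^+ 3).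
Proof.
have r0 : smooth_abs y != 0 by rewrite gt_eqF ?smooth_abs_gt0.
have dr := is_derive_smooth_abs y.
apply: (is_derive_eq (is_deriveV r0 dr)).
by rewrite /GRing.scale/=; field.
Qed.

Lemma is_derive_smooth_neg (y : R) : is_derive y 1 smooth_neg (smooth_neg' y).
Proof.
have dr := is_derive_smooth_abs y.
rewrite /smooth_neg.
apply: is_derive_eq.
rewrite /smooth_neg' /GRing.scale/=; ring.
Qed.

Lemma smooth_neg0 : smooth_neg 0 = 0.
Proof.
rewrite /smooth_neg /smooth_abs expr0n add0r sqrtr_sqr ger0_norm; last exact: ltW.
by rewrite subr0 subrr mul0r.
Qed.

Lemma smooth_neg'_itv y : -1 <= smooth_neg' y <= 0.
Proof.
have r0 := smooth_abs_gt0 y; have := smooth_abs_ge_norm y; rewrite ler_norml => /andP[h1 h2].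
have : -1 <= y * (smooth_abs y)^-1 <= 1.
  by rewrite ler_pdivlMr// ler_pdivrMr// mulN1r mul1r h1 h2.
by rewrite /smooth_neg'; lra.
Qed.

Lemma smooth_neg_lip y z : `|smooth_neg y - smooth_neg z| <= `|y - z|.
Proof.
wlog yz : y z / y <= z.
  move=> h; have [/h//|/ltW/h] := leP y z.
  by rewrite distrC [in leRHS]distrC.
have ry := smooth_abs_gt0 y; have rz := smooth_abs_gt0 z.
have : `|smooth_abs y - smooth_abs z| <= `|y - z|.
  have := smooth_abs_ge_norm y; have := smooth_abs_ge_norm z.
  have := sqr_smooth_abs y; have := sqr_smooth_abs z.
  rewrite (ler0_norm (_ : y - z <= 0)); last by lra.
  rewrite !ler_norml; move: ry rz; set a := smooth_abs y; set b := smooth_abs z => a0 b0 b2 a2 hz hy.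
  have ab0 : 0 < a + b by lra.
  have E : (a - b) * (a + b) = (y - z) * (y + z) by rewrite -!subr_sqr a2 b2; ring.
  have yz1 : y + z <= a + b by lra.
  have yz2 : - (a + b) <= y + z by lra.
  apply/andP; split.
    rewrite -(ler_pM2r ab0) E; nra.
  rewrite -(ler_pM2r ab0) E; nra.
rewrite /smooth_neg !ler_norml (ler0_norm (_ : y - z <= 0)); lra.
Qed.

Lemma smooth_neg_approx y : `|smooth_neg y - negpart y| <= e.
Proof.
rewrite /negpart.
have ry := smooth_abs_gt0 y; have rn := smooth_abs_ge_norm y.
have r2 := sqr_smooth_abs y.
have rb : smooth_abs y <= `|y| + e.
  have := normr_ge0 y; have := real_normK (num_real y).
  move: rn ry r2; set r := smooth_abs y; set a := `|y| => ar r0 r2 a2 a0.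
  have ae : 0 <= a * e by rewrite mulr_ge0// ltW.
  rewrite leNgt; apply/negP => h.
  have : 0 < (r - (a + e)) * (r + (a + e)) by apply: mulr_gt0; have := e0; lra.
  nra.
rewrite /smooth_neg ler_norml; move: rn rb; have [y0|y0] := leP 0 y.
  rewrite ger0_norm// => *; rewrite max_r; lra.
rewrite ltr0_norm// => *; rewrite max_l; lra.
Qed.

(** The inverse r of [smooth_abs] has derivative - y r^3, again a polynomial in y
    and r, which closes the induction on the order. *)
Lemma Ck_smooth_absV n m (f : 'rV[R]_n -> R) :
  Ck m f -> Ck m ((fun y => (smooth_abs y)^-1) \o f).
Proof.
elim: m f => [|m IH] f Cf.
  move=> x; apply: continuous_comp; first exact: Cf.
  apply/differentiable_continuous/derivable1_diffP.
  by have [] := is_derive_smooth_absV (f x).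
apply: (Ck_compS (h' := fun y => - y * (smooth_abs y)^-1 ^+ 3)) => //.
  exact: is_derive_smooth_absV.
have Cf' := CkS Cf; have Cr := IH _ Cf'.
have := CkM (CkM (Ck_cst _ m (-1)) Cf') (CkM Cr (CkM Cr Cr)).
by congr Ck; apply/funext => x /=; ring.
Qed.

Lemma smooth_neg_smooth n (f : 'rV[R]_n -> R) :
  smooth_on [set: 'rV[R]_n] f -> smooth_on [set: 'rV[R]_n] (smooth_neg \o f).
Proof.
move=> /smooth_CkP Cf; apply/smooth_CkP => m; apply: CkS.
apply: (Ck_compS (h' := smooth_neg')) => //; first exact: is_derive_smooth_neg.
have := CkM (CkD (CkM (Cf m) (Ck_smooth_absV (Cf m))) (Ck_cst _ m (-1))) (Ck_cst _ m (2^-1)).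
by congr Ck.
Qed.

Lemma smooth_neg_test n (Omega : set 'rV[R]_n) (f : 'rV[R]_n -> R) :
  test_function Omega f -> test_function Omega (smooth_neg \o f).
Proof.
move=> [sf [K [cK KO fK]]]; split; first exact: smooth_neg_smooth.
by exists K; split => // x /fK /= ->; exact: smooth_neg0.
Qed.

Lemma partial_smooth_neg n (f : 'rV[R]_n -> R) i x :
  smooth_on [set: 'rV[R]_n] f ->
  partial i (smooth_neg \o f) x = smooth_neg' (f x) * partial i f x.
Proof.
move=> sf; have [_ df] := sf [::] x I.
by have [_ <-] := is_derive_comp1 (df i) (is_derive_smooth_neg (f x)).
Qed.

End smooth_negpart.

(** * The elliptic term against the negative part *)

Lemma cvg_sumr (R : realType) (I : Type) (s : seq I) (u : I -> nat -> R) (l : I -> R) :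
  (forall i, u i k @[k --> \oo] --> l i) ->
  \sum_(i <- s) u i k @[k --> \oo] --> \sum_(i <- s) l i.
Proof.
move=> ul; elim: s => [|i s IH].
  by rewrite big_nil; under eq_fun do rewrite big_nil; exact: cvg_cst.
rewrite big_cons; under eq_fun do rewrite big_cons.
by apply: cvgD; [exact: ul|exact: IH].
Qed.

Section elliptic.
Variables (R : realType) (n : nat).
Local Notation mu := (lebesgue_rV R n).

Lemma test_function_C0 (Omega : set 'rV[R]_n) f : test_function Omega f ->
  C0_closure Omega f /\ forall i, C0_closure Omega (partial i f).
Proof.
move=> [sf _]; split.
  by apply: continuous_subspaceT => x; exact: (sf [::] x I).1.
by move=> i; apply: continuous_subspaceT => x; exact: (sf [:: i] x I).1.
Qed.

Lemma C0_closure_sqintegrable (Omega : set 'rV[R]_n) f : open Omega ->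
  bounded_set Omega -> C0_closure Omega f -> sqintegrable mu Omega f.
Proof.
move=> oO bO cf; have [C fC] := C0_closure_bounded bO cf.
apply: (@sqintegrable_bounded _ _ _ _ _ _ C) => //.
- exact: open_measurable_rV.
- exact: bounded_lebesgue_rV_lty.
- exact: C0_closure_measurable.
Qed.

Variables (Omega : set 'rV[R]_n) (A : 'I_n -> 'I_n -> 'rV[R]_n -> R).
Hypotheses (oO : open Omega) (bO : bounded_set Omega).
Hypothesis cA : forall i j, C0_closure Omega (A i j).
Hypothesis A_ge0 : forall x, Omega x -> forall xi : 'I_n -> R,
  0 <= \sum_i \sum_j A i j x * xi i * xi j.

Variables (f : 'rV[R]_n -> R) (g : 'I_n -> 'rV[R]_n -> R)
  (P : 'I_n -> 'I_n -> 'rV[R]_n -> R).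
Hypothesis hf : H1_0 Omega f g.
Hypothesis LP : forall i j, sqintegrable mu Omega (P i j).
Hypothesis wP : forall i j,
  weak_partial Omega i (fun x => A i j x * g j x) (P i j).

Let mO : measurable Omega. Proof. exact: open_measurable_rV. Qed.

Let Lf : sqintegrable mu Omega f.
Proof. by apply: L2_sqintegrable => //; case: hf. Qed.

Let Lg i : sqintegrable mu Omega (g i).
Proof. by apply: L2_sqintegrable => //; case: hf => _ /(_ i)[]. Qed.

Let LAg i j : sqintegrable mu Omega (fun x => A i j x * g j x).
Proof.
have [C AC] := C0_closure_bounded bO (@cA i j).
by apply: (@sqintegrableM _ _ _ _ _ _ _ C) => //; exact: C0_closure_measurable.
Qed.

Let S x := \sum_i \sum_j P i j x.

Let LS : sqintegrable mu Omega S.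
Proof. by apply: sqintegrable_sum => // i; exact: sqintegrable_sum. Qed.

(** Let phi k be the test functions that converge to f in H^1 and psi k their
    truncations.  With beta k = - smooth_neg' e (phi k), which lies in [0, 1],
    the weak derivatives turn the integral of S psi k into that of
    A g . (beta k grad (phi k)).  Replacing grad (phi k) by g leaves the
    nonnegative form beta k A g . g and an error zeta that tends to 0 in L^2,
    because beta k is bounded uniformly in k. *)
Lemma elliptic_smooth_neg e : 0 < e ->
  0 <= \int[mu]_(x in Omega) (S x * smooth_neg e (f x)).
Proof.
move=> e0; have [_ _ [phi [tphi cphi cdphi]]] := hf.
pose psi k := smooth_neg e \o phi k.
have tpsi k : test_function Omega (psi k) by exact: smooth_neg_test.
have mpsi (h : 'rV[R]_n -> R) : measurable_fun Omega h ->
    measurable_fun Omega (smooth_neg e \o h).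
  move=> mh; apply: measurableT_comp => //.
  apply: continuous_measurable_fun => y.
  apply/differentiable_continuous/derivable1_diffP.
  by have [] := is_derive_smooth_neg e0 y.
have mpsi' (h : 'rV[R]_n -> R) : measurable_fun Omega h ->
    measurable_fun Omega (smooth_neg' e \o h).
  move=> mh; apply: measurableT_comp => //.
  rewrite /smooth_neg'; apply: measurable_funM => //.
  apply: measurable_funB => //; apply: measurable_funM => //.
  apply: continuous_measurable_fun => y.
  apply/differentiable_continuous/derivable1_diffP.
  by have [] := is_derive_smooth_absV e0 y.
have Lphi k : sqintegrable mu Omega (phi k).
  by apply: C0_closure_sqintegrable => //; exact: (test_function_C0 (tphi k)).1.
have Ldphi k i : sqintegrable mu Omega (partial i (phi k)).
  by apply: C0_closure_sqintegrable => //; exact: (test_function_C0 (tphi k)).2.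
have Lpsi k : sqintegrable mu Omega (psi k).
  by apply: C0_closure_sqintegrable => //; exact: (test_function_C0 (tpsi k)).1.
have Lpsif : sqintegrable mu Omega (smooth_neg e \o f).
  apply: sqintegrable_le Lf => //; first exact: mpsi Lf.1.
  by move=> x _; have := smooth_neg_lip e0 (f x) 0; rewrite smooth_neg0// !subr0.
have cpsi : sqcvg mu Omega psi (smooth_neg e \o f).
  apply: (@sqcvg_le _ _ _ _ _ phi f _ _ 1) => //.
  - by move=> k; exact: (Lphi k).1.
  - exact: Lf.1.
  - by move=> k; exact: (Lpsi k).1.
  - exact: Lpsif.1.
  - by move=> k x _; rewrite mul1r; exact: smooth_neg_lip.
  - exact: L2_cvg_sqcvg.
pose beta k x := - smooth_neg' e (phi k x).
have beta01 k x : 0 <= beta k x <= 1.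
  by have := smooth_neg'_itv e0 (phi k x); rewrite /beta; lra.
have betaC k x : Omega x -> `|beta k x| <= 1.
  by move=> _; have := beta01 k x; rewrite ler_norml; lra.
have mbeta k : measurable_fun Omega (beta k).
  by apply: measurableT_comp => //; exact: (mpsi' _ (Lphi k).1).
pose zeta i k x := beta k x * (partial i (phi k) x - g i x).
have Lzeta i k : sqintegrable mu Omega (zeta i k).
  by apply: (@sqintegrableM _ _ _ _ _ _ _ 1) => //; [exact: betaC|exact: sqintegrableB].
have czeta i : sqcvg mu Omega (zeta i) (fun=> 0).
  apply: (@sqcvg_le _ _ _ _ _ (fun k => partial i (phi k)) (g i) _ _ 1) => //.
  - by move=> k; exact: (Ldphi k i).1.
  - exact: (Lg i).1.
  - by move=> k; exact: (Lzeta i k).1.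
  - move=> k x Ox; rewrite subr0 normrM ler_wpM2r//; exact: betaC.
  - exact: L2_cvg_sqcvg.
have Lbg i k : sqintegrable mu Omega (fun x => beta k x * g i x).
  by apply: (@sqintegrableM _ _ _ _ _ _ _ 1) => //; exact: betaC.
pose E k := \sum_i \sum_j \int[mu]_(x in Omega) ((A i j x * g j x) * zeta i k x).
have key k : E k <= \int[mu]_(x in Omega) (S x * psi k x).
  have -> : \int[mu]_(x in Omega) (S x * psi k x) =
      \sum_i \sum_j \int[mu]_(x in Omega) (P i j x * psi k x).
    transitivity (\int[mu]_(x in Omega) (\sum_i \sum_j (P i j x * psi k x))).
      apply: eq_Rintegral => x _; rewrite mulr_suml.
      by apply: eq_bigr => i _; rewrite mulr_suml.
    rewrite Rintegral_sum//.
      apply: eq_bigr => i _; rewrite Rintegral_sum// => j.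
      exact: sqintegrable_mul.
    by move=> i; apply: integrable_sumr => // j; exact: sqintegrable_mul.
  have wk i j : \int[mu]_(x in Omega) (P i j x * psi k x) =
      \int[mu]_(x in Omega) ((A i j x * g j x) * (beta k x * g i x)) +
      \int[mu]_(x in Omega) ((A i j x * g j x) * zeta i k x).
    rewrite -RintegralD//; [|exact: (sqintegrable_mul mO (LAg i j) (Lbg i k))
      |exact: (sqintegrable_mul mO (LAg i j) (Lzeta i k))].
    have := wP i j (tpsi k) => /eqP; rewrite eq_sym eqr_oppLR => /eqP ->.
    rewrite -mulN1r -RintegralZl//; last first.
      apply: sqintegrable_mul => //; apply: C0_closure_sqintegrable => //.
      exact: (test_function_C0 (tpsi k)).2.
    apply: eq_Rintegral => x _; rewrite partial_smooth_neg//; last exact: (tphi k).1.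
    rewrite /zeta /beta; ring.
  under eq_bigr do under eq_bigr do rewrite wk.
  under eq_bigr do rewrite big_split.
  rewrite big_split/= -/(E k) lerDr.
  rewrite (_ : \sum_i _ = \int[mu]_(x in Omega)
      (\sum_i \sum_j (A i j x * g j x) * (beta k x * g i x))); last first.
    rewrite Rintegral_sum//.
      apply: eq_bigr => i _; rewrite Rintegral_sum// => j.
      exact: sqintegrable_mul.
    by move=> i; apply: integrable_sumr => // j; exact: sqintegrable_mul.
  apply: Rintegral_ge0 => x Ox.
  rewrite (_ : \sum_i _ = beta k x * \sum_i \sum_j A i j x * g i x * g j x); last first.
    rewrite mulr_sumr; apply: eq_bigr => i _; rewrite mulr_sumr.
    by apply: eq_bigr => j _; ring.
  by rewrite mulr_ge0//; [have /andP[] := beta01 k x|exact: (A_ge0 Ox (fun i => g i x))].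
have cE : E k @[k --> \oo] --> 0.
  rewrite (_ : 0 = \sum_(i < n) \sum_(j < n) (0 : R)); last first.
    by rewrite !big1// => i _; rewrite big1.
  apply: cvg_sumr => i; apply: cvg_sumr => j.
  have -> : (0 : R) = \int[mu]_(x in Omega) ((A i j x * g j x) * 0).
    by under eq_Rintegral do rewrite mulr0; rewrite /Rintegral integral0.
  apply: (@cvg_Rintegral_mul _ _ _ _ _ (fun=> fun x => A i j x * g j x) _ (zeta i)) => //.
    rewrite /sqcvg; under eq_fun do under eq_integral do rewrite subrr expr0n.
    under eq_fun do rewrite integral0; exact: cvg_cst.
  split => //; under eq_fun do rewrite expr0n; exact: integrable0.
have cS : \int[mu]_(x in Omega) (S x * psi k x) @[k --> \oo] -->
    \int[mu]_(x in Omega) (S x * smooth_neg e (f x)).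
  apply: (@cvg_Rintegral_mul _ _ _ _ _ (fun=> S)) => //.
  rewrite /sqcvg; under eq_fun do under eq_integral do rewrite subrr expr0n.
  under eq_fun do rewrite integral0; exact: cvg_cst.
rewrite -(cvg_lim _ cE)// -(cvg_lim _ cS)//.
by apply: ler_lim; [apply/cvg_ex; exists 0|apply/cvg_ex; eexists; exact: cS|apply: nearW].
Qed.

(** [smooth_neg e] tends to [negpart] uniformly as e goes to 0, and S is
    integrable because Omega has finite measure. *)
Lemma elliptic_negpart :
  0 <= \int[mu]_(x in Omega) (S x * negpart (f x)).
Proof.
have iS : mu.-integrable Omega (fun x => (S x)%:E).
  have L1 : sqintegrable mu Omega (fun=> 1).
    apply: (@sqintegrable_bounded _ _ _ _ _ _ 1) => //.
      exact: bounded_lebesgue_rV_lty.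
    by move=> x _; rewrite normr1.
  by have := sqintegrable_mul mO LS L1; under eq_fun do rewrite mulr1.
have Lneg : sqintegrable mu Omega (fun x => negpart (f x)).
  apply: sqintegrable_le (Lf) => //; first by apply: measurable_negpart; exact: Lf.1.
  by move=> x _; exact: negpart_le_norm.
have iSn := sqintegrable_mul mO LS Lneg.
apply/ler_addgt0Pr => /= d d0; rewrite -lerBlDr sub0r.
pose I := \int[mu]_(x in Omega) `|S x|.
have I0 : 0 <= I by apply: Rintegral_ge0.
(* the truncation error is at most e * I, hence at most d *)
pose e := d / (I + 1).
have e0 : 0 < e by rewrite divr_gt0// ltr_wpDl.
have eI : e * I <= d.
  by rewrite /e mulrAC ler_pdivrMr ?ltr_wpDl// ler_pM2l// lerDl.
have := elliptic_smooth_neg e0.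
have Lpsif : sqintegrable mu Omega (smooth_neg e \o f).
  apply: sqintegrable_le Lf => //.
    apply: measurableT_comp => //; last exact: Lf.1.
    apply: continuous_measurable_fun => y.
    apply/differentiable_continuous/derivable1_diffP.
    by have [] := is_derive_smooth_neg e0 y.
  by move=> x _; have := smooth_neg_lip e0 (f x) 0; rewrite smooth_neg0// !subr0.
have iSp := sqintegrable_mul mO LS Lpsif.
have iSe := integrableZl mO e (integrable_abse iS).
suff : \int[mu]_(x in Omega) (S x * smooth_neg e (f x)) <=
    \int[mu]_(x in Omega) (S x * negpart (f x)) + e * I by lra.
rewrite /I -RintegralZl//; last exact: (integrable_abse iS).
rewrite -RintegralD//.
apply: le_Rintegral => //.
  exact: (integrableD mO iSn iSe).
move=> x Ox; rewrite -lerBlDl -mulrBr (le_trans (ler_norm _))// normrM mulrC.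
by rewrite ler_wpM2r//; exact: smooth_neg_approx.
Qed.

End elliptic.

(** * The singular kernel *)

Section singular_kernel.
Variable R : realType.
Local Notation leb := (@lebesgue_measure R).

(** The integrand may blow up at either end: the fundamental theorem of calculus
    is applied on closed subintervals, which exhaust the open one, and monotone
    convergence does the rest. *)
Lemma integral_itvoo_le_antiderivative (f F : R -> R) (a b M : R) : a < b ->
  {in `]a, b[, forall x, 0 <= f x} ->
  {in `]a, b[, forall x : R, is_derive x 1 F (f x)} ->
  {in `]a, b[, continuous f} ->
  (forall c d, a < c -> c < d -> d < b -> F d - F c <= M) ->
  (\int[leb]_(x in `]a, b[) (f x)%:E <= M%:E)%E.
Proof.
move=> ab f0 dF cf FM.
(* the denominator m + 2 keeps a + r m < b - r m already for m = 0 *)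
pose r (m : nat) : R := (b - a) / 2 / m.+2%:R.
have ab0 : 0 < (b - a) / 2 by lra.
have r0 m : 0 < r m by rewrite divr_gt0.
have rlt m : r m < (b - a) / 2 by rewrite ltr_pdivrMr// ltr_pMr// ltr1n.
pose I m := `[a + r m, b - r m]%classic.
have Isub m x : I m x -> x \in `]a, b[.
  by rewrite /I /= !in_itv/=; have := r0 m; lra.
have IU : `]a, b[%classic = \bigcup_m I m.
  apply/seteqP; split => [x|x [m _ /Isub]//].
  rewrite /= in_itv/= => /andP[ax xb].
  pose e := Num.min (x - a) (b - x).
  have e0 : 0 < e by rewrite lt_min; apply/andP; split; lra.
  have /ltr_add_invr[k] : 0 < e / ((b - a) / 2) by rewrite divr_gt0.
  rewrite add0r ltr_pdivlMr// mulrC => hk.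
  have rk : r k <= e.
    apply: le_trans (ltW hk); rewrite /r ler_pM2l// lef_pV2 ?posrE// ler_nat//.
  exists k => //; rewrite /I /= in_itv/=.
  by move: rk; rewrite le_min => /andP[? ?]; apply/andP; split; lra.
have mfI m : measurable_fun (I m) (EFin \o f).
  apply/measurable_EFinP.
  apply: (@measurable_funS _ _ _ _ `]a, b[%classic) => //; first by move=> x /Isub.
  by apply: open_continuous_measurable_fun; [exact: interval_open|move=> x /[!inE]; exact: cf].
have ndI : nondecreasing_seq I.
  apply/nondecreasing_seqP => m; apply/subsetPset => x; rewrite /I /= !in_itv/=.
  have : r m.+1 <= r m by rewrite /r ler_pM2l// lef_pV2 ?posrE// ler_nat.
  by move=> h /andP[? ?]; apply/andP; split; lra.
have cI : (\int[leb]_(x in I m) (f x)%:E)%E @[m --> \oo] -->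
    (\int[leb]_(x in \bigcup_m I m) (f x)%:E)%E.
  apply: (@ge0_nondecreasing_set_cvg_integral _ (measurableTypeR R) R I
    (EFin \o f) leb) => //; first by move=> m; exact: measurable_itv.
  by move=> m x Imx; rewrite lee_fin f0//; exact: Isub Imx.
rewrite IU; apply: cvge_le cI; apply: nearW => m.
have ltI : a + r m < b - r m by have := rlt m; lra.
have inI x : x \in `[a + r m, b - r m] -> x \in `]a, b[.
  by move=> h; apply: (Isub m).
have cF x : x \in `]a, b[ -> {for x, continuous F}.
  by move=> xab; apply/differentiable_continuous/derivable1_diffP; have [] := dF _ xab.
rewrite (continuous_FTC2 (F := F))//.
- by rewrite -EFinB lee_fin; apply: FM; have := r0 m; lra.
- by apply: continuous_in_subspaceT => x /[!inE] /Isub; exact: cf.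
- split.
  + by move=> x xI; have [] := dF _ (inI _ (subset_itv_oo_cc xI)).
  + apply: cvg_at_right_filter; apply: cF; apply: inI.
    by rewrite in_itv/= lexx/= ltW.
  + apply: cvg_at_left_filter; apply: cF; apply: inI.
    by rewrite in_itv/= lexx/= ltW.
- by move=> x xI; rewrite derive1E; have [] := dF _ (inI _ (subset_itv_oo_cc xI)).
Qed.

Variable alpha : R.
Hypothesis alpha01 : 0 < alpha < 1.

Let a0 : 0 < alpha. Proof. by case/andP: alpha01. Qed.
Let a1 : 0 < 1 - alpha. Proof. by rewrite subr_gt0; case/andP: alpha01. Qed.

Lemma is_derive_powR_primitive (y : R) : 0 < y ->
  is_derive y 1 (fun y => y `^ (1 - alpha) / (1 - alpha)) (y `^ (- alpha)).
Proof.
move=> y0; have d := is_derive1_powR (1 - alpha) y0.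
have := is_deriveM d (is_derive_cst (1 - alpha)^-1 y 1).
have -> // : y `^ (1 - alpha) *: (0 : R) +
    (1 - alpha)^-1 *: ((1 - alpha) * y `^ (1 - alpha - 1)) = y `^ (- alpha).
rewrite /GRing.scale/= mulr0 add0r mulrA mulVf ?gt_eqF// mul1r.
by congr (_ `^ _); ring.
Qed.

Lemma powR_primitive_ge0 (y : R) : 0 <= y `^ (1 - alpha) / (1 - alpha).
Proof. by rewrite divr_ge0 ?powR_ge0// ltW. Qed.

Lemma powR_primitive_le (y z : R) : 0 <= y -> y <= z ->
  y `^ (1 - alpha) / (1 - alpha) <= z `^ (1 - alpha) / (1 - alpha).
Proof.
move=> y0 yz; rewrite ler_pM2r ?invr_gt0// ge0_ler_powR ?nnegrE//; first exact: ltW.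
exact: le_trans yz.
Qed.

Lemma continuous_powRx (p y : R) : 0 < y -> {for y, continuous (@powR R ^~ p)}.
Proof.
move=> y0; apply/differentiable_continuous/derivable1_diffP.
by have [] := is_derive1_powR p y0.
Qed.

Lemma integral_powR_subl (a b : R) : a < b ->
  (\int[leb]_(t in `]a, b[) ((t - a) `^ (- alpha))%:E <=
   ((b - a) `^ (1 - alpha) / (1 - alpha))%:E)%E.
Proof.
move=> ab.
apply: (@integral_itvoo_le_antiderivative _
   (fun t => (t - a) `^ (1 - alpha) / (1 - alpha))) => //.
- by move=> x _; exact: powR_ge0.
- move=> x; rewrite in_itv/= => /andP[ax xb].
  have xa0 : 0 < x - a by rewrite subr_gt0.
  have ds : is_derive x 1 (fun x : R => x - a) 1.
    by apply: is_derive_eq; rewrite subr0.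
  have := @is_derive1_comp _ _ (fun x : R => x - a) _ _ _ (is_derive_powR_primitive xa0) ds.
  by rewrite mulr1.
- move=> x; rewrite in_itv/= => /andP[ax xb].
  apply: (@continuous_comp _ _ _ (fun x : R => x - a) (@powR R ^~ (- alpha))).
    by apply: continuousB; [exact: cvg_id|exact: cvg_cst].
  by apply: continuous_powRx; rewrite subr_gt0.
- move=> c d ac cd db.
  have := @powR_primitive_le (d - a) (b - a); have := powR_primitive_ge0 (c - a).
  by move=> h1 h2; have := h2; lra.
Qed.

Lemma integral_powR_subr (t : R) : 0 < t ->
  (\int[leb]_(s in `]0%R, t[) ((t - s) `^ (- alpha))%:E <=
   (t `^ (1 - alpha) / (1 - alpha))%:E)%E.
Proof.
move=> t0.
apply: (@integral_itvoo_le_antiderivative _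
   (fun s => - ((t - s) `^ (1 - alpha) / (1 - alpha)))) => //.
- by move=> x _; exact: powR_ge0.
- move=> x; rewrite in_itv/= => /andP[x0 xt].
  have xa0 : 0 < t - x by rewrite subr_gt0.
  have ds : is_derive x 1 (fun x : R => t - x) (-1).
    by have := is_deriveB (is_derive_cst t x 1) (is_derive_id x 1); rewrite sub0r.
  have := is_deriveN (@is_derive1_comp _ _ (fun x : R => t - x) _ _ _ (is_derive_powR_primitive xa0) ds).
  by rewrite mulrN1 opprK.
- move=> x; rewrite in_itv/= => /andP[x0 xt].
  apply: (@continuous_comp _ _ _ (fun x : R => t - x) (@powR R ^~ (- alpha))).
    by apply: continuousB; [exact: cvg_cst|exact: cvg_id].
  by apply: continuous_powRx; rewrite subr_gt0.
- move=> c d ac cd db.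
  have := @powR_primitive_le (t - c) t; have := powR_primitive_ge0 (t - d).
  by move=> h1 h2; have := h2; lra.
Qed.

(** The content is finiteness: [Gamma] is a real-valued integral, which would be
    0 if it diverged.  Near 0 the integrand is compared with s^(- alpha), and
    beyond 1 with the exponential density. *)
Lemma Gamma_gt0 : 0 < Gamma (1 - alpha).
Proof.
rewrite /Gamma.
pose f (s : R) := s `^ (1 - alpha - 1) * expR (- s).
have fE s : f s = s `^ (- alpha) * expR (- s) by rewrite /f; congr (_ `^ _ * _); ring.
have f0 s : 0 <= f s by rewrite mulr_ge0 ?powR_ge0 ?expR_ge0.
have mf D : measurable_fun D f.
  apply: measurable_funTS; apply: measurable_funM.
    exact: measurable_powR.
  by apply: measurableT_comp => //.
have i01 : (\int[leb]_(s in `]0%R, 1%R[) (f s)%:E < +oo)%E.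
  apply: (@le_lt_trans _ _ (\int[leb]_(s in `]0%R, 1%R[) ((s - 0) `^ (- alpha))%:E)%E).
    apply: ge0_le_integral => //.
    - by move=> s _; rewrite lee_fin.
    - by apply/measurable_EFinP; exact: mf.
    - apply/measurable_EFinP; apply: measurable_funTS.
      by apply: (measurableT_comp (measurable_powR (- alpha))) => //; exact: measurable_funB.
    - move=> s; rewrite /= in_itv/= => /andP[s0 s1]; rewrite lee_fin fE subr0.
      rewrite ler_piMr ?powR_ge0// -expR0 ler_expR; lra.
  by apply: le_lt_trans (integral_powR_subl ltr01) _; rewrite ltry.
have i1y : (\int[leb]_(s in `[1%R, +oo[) (f s)%:E < +oo)%E.
  apply: (@le_lt_trans _ _ (\int[leb]_(s in `[1%R, +oo[) (exponential_pdf 1 s)%:E)%E).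
    apply: ge0_le_integral => //.
    - by move=> s _; rewrite lee_fin.
    - by apply/measurable_EFinP; exact: mf.
    - by apply/measurable_EFinP; apply: measurable_funTS; exact: measurable_exponential_pdf.
    - move=> s; rewrite /= in_itv/= andbT => s1; rewrite lee_fin fE.
      rewrite exponential_pdfE; last by rewrite (le_trans _ s1).
      rewrite mul1r mulN1r ler_piMl ?expR_ge0//.
      rewrite powRN invf_le1 ?powR_gt0//; last by rewrite (lt_le_trans _ s1).
      by rewrite -(powRr0 s) ler_powR// ltW.
  apply: (@le_lt_trans _ _ (\int[leb]_s (exponential_pdf 1 s)%:E)%E).
    apply: ge0_subset_integral => //.
      by apply/measurable_EFinP; exact: measurable_exponential_pdf.
    by move=> s _; rewrite lee_fin exponential_pdf_ge0.
  by rewrite integral_exponential_pdf// ltry.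
rewrite -/f.
have -> : `]0%R, +oo[%classic = `]0%R, 1%R[%classic `|` `[1%R, +oo[%classic :> set R.
  apply/seteqP; split => x /=; rewrite !in_itv/= ?andbT.
    by move=> x0; have [x1|x1] := ltP x 1; [left; rewrite x0|right].
  by case=> [/andP[]//|x1]; rewrite (lt_le_trans _ x1).
have ltoo : (\int[leb]_(s in `]0%R, 1%R[ `|` `[1%R, +oo[) (f s)%:E < +oo)%E.
  rewrite ge0_integral_setU//=.
  - by rewrite lte_add_pinfty.
  - by apply/measurable_EFinP; exact: mf.
  - by move=> s _; rewrite lee_fin.
  - apply/disj_setPS => s [] /=; rewrite !in_itv/= andbT => /andP[_ s1] s1'.
    by move: s1; rewrite ltNge s1'.
apply: fine_gt0; rewrite ltoo andbT.
apply: (@lt_le_trans _ _ (\int[leb]_(s in `]0%R, 1%R[) (expR (-1))%:E)%E).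
  rewrite integral_cst//=. rewrite lebesgue_measure_itv/= lte_fin ltr01 oppr0 adde0.
  by rewrite mule1 lte_fin expR_gt0.
apply: (@le_trans _ _ (\int[leb]_(s in `]0%R, 1%R[) (f s)%:E)%E).
  apply: ge0_le_integral => //.
    by apply/measurable_EFinP; exact: mf.
  move=> s; rewrite /= in_itv/= => /andP[s0 s1]; rewrite lee_fin fE.
    rewrite -[leLHS]mul1r ler_pM ?expR_ge0// ?ler_expR; last lra.
    rewrite powRN -[leLHS]invr1 lef_pV2 ?posrE ?powR_gt0//.
    have -> : (1 : R) = 1 `^ alpha by rewrite powR1.
    rewrite ge0_ler_powR ?nnegrE//; exact: ltW.
apply: ge0_subset_integral => //.
- by apply: measurableU.
- by apply/measurable_EFinP; exact: mf.
- by move=> s _; rewrite lee_fin.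
Qed.

End singular_kernel.

(** * Extension of a function of time *)

Section clamp.
Variables (R : realType) (T : R).
Hypothesis T0 : 0 < T.

Definition clamp (t : R) : R := Num.min (Num.max t 0) T.

Lemma clamp_itv t : 0 <= clamp t <= T.
Proof.
rewrite /clamp ge_min lexx orbT andbT le_min le_max lexx orbT/=; exact: ltW.
Qed.

Lemma clamp_id t : 0 <= t <= T -> clamp t = t.
Proof. by move=> /andP[t0 tT]; rewrite /clamp max_l// min_l. Qed.

Lemma clamp_le0 t : t <= 0 -> clamp t = 0.
Proof. by move=> t0; rewrite /clamp max_r// min_l// ltW. Qed.

Lemma clamp_lip s t : `|clamp s - clamp t| <= `|s - t|.
Proof.
have := T0; rewrite /clamp => T0'.
have [hs|hs] := leP s 0; have [ht|ht] := leP t 0;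
  rewrite ?(min_l (ltW T0')); try have [hs'|hs'] := leP s T;
  try have [ht'|ht'] := leP t T;
  have [h|h] := leP 0 (s - t); rewrite ?(ger0_norm h) ?(ltr0_norm h) ?ler_norml; lra.
Qed.

Lemma continuous_clamp : continuous clamp.
Proof.
move=> y; apply/cvgrPdist_le => e e0; near=> z.
apply: le_trans (clamp_lip _ _) _.
by near: z; apply: cvgr_dist_le => //; exact: cvg_id.
Unshelve. all: by end_near. Qed.

Lemma continuous_comp_clamp (v : R -> R) :
  {within `[0, T], continuous v} -> continuous (v \o clamp).
Proof.
move=> /subspace_continuousP cv t.
have ct : `[0, T]%classic (clamp t) by rewrite /= in_itv/= clamp_itv.
apply: cvg_comp (cv _ ct) => A /=.
rewrite /within/= => hA.
have h2 : nbhs t (clamp @^-1` [set y | `[0, T]%classic y -> A y]) := continuous_clamp hA.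
apply: (@filterS _ (nbhs t) _ _ _ _ h2) => y /=; apply.
by rewrite in_itv/= clamp_itv.
Qed.

End clamp.

(** * Backward differences of the negative part *)

Section caputo_step.
Variables (R : realType) (T lam a : R) (v : R -> R).
Hypotheses (T0 : 0 < T) (a_ge0 : 0 <= a).
Hypotheses (C1v : C1_itv T v) (v00 : v 0 = 0).
Local Notation leb := (@lebesgue_measure R).

Let vc := v \o clamp T.
(** Clamping extends v by v 0 = 0 to negative times, where v + a is then the
    nonnegative constant a and its negative part vanishes. *)
Definition clamp_negpart (t : R) := negpart (v (clamp T t) + a).
Definition weighted_negpart2 (t : R) := expR (- (lam * t)) * clamp_negpart t ^+ 2.

Lemma C1_itv_continuous_comp : continuous vc.
Proof. by apply: continuous_comp_clamp => //; case: C1v. Qed.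

Lemma continuous_clamp_negpart : continuous clamp_negpart.
Proof.
move=> t; apply: (@continuous_comp _ _ _ (fun t => vc t + a) (@negpart R)).
  by apply: continuousD; [exact: C1_itv_continuous_comp|exact: cvg_cst].
exact: continuous_negpart.
Qed.

Lemma continuous_weight : continuous (fun t : R => expR (- (lam * t))).
Proof.
move=> t; apply: (@continuous_comp _ _ _ (fun t => - (lam * t)) expR).
  by apply: continuousN; apply: continuousM; [exact: cvg_cst|exact: cvg_id].
exact: continuous_expR.
Qed.

Lemma continuous_weighted_negpart2 : continuous weighted_negpart2.
Proof.
move=> t; apply: (@continuousM _ _ (fun t => expR (- (lam * t))) (fun t => clamp_negpart t ^+ 2)).
  exact: continuous_weight.
apply: (@continuous_comp _ _ _ clamp_negpart (fun y : R => y ^+ 2)).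
  exact: continuous_clamp_negpart.
exact: exprn_continuous.
Qed.

Lemma clamp_negpart_le0 t : t <= 0 -> clamp_negpart t = 0.
Proof.
by move=> t0; rewrite /clamp_negpart clamp_le0// v00 add0r /negpart max_r// oppr_le0.
Qed.

Lemma weighted_negpart2_ge0 t : 0 <= weighted_negpart2 t.
Proof. by rewrite mulr_ge0 ?expR_ge0 ?sqr_ge0. Qed.

Lemma continuous_itvoo_integrable (f : R -> R) b c : continuous f ->
  leb.-integrable `]b, c[ (EFin \o f).
Proof.
move=> cf; apply: (@integrableS _ _ _ leb `[b, c]%classic `]b, c[%classic) => //.
  by apply: subset_itv; rewrite bnd_simp.
apply: continuous_compact_integrable; first exact: segment_compact.
exact: continuous_subspaceT.
Qed.

(** The shifted function is zero up to time theta, by the sign of the initial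
    value a, and what the shift moves beyond T only decreases the integral. *)
Lemma weighted_negpart2_shift_le (theta : R) : 0 < theta ->
  \int[leb]_(t in `]0, T[) weighted_negpart2 (t - theta) <=
  \int[leb]_(t in `]0, T[) weighted_negpart2 t.
Proof.
move=> th0.
have cs : continuous (fun t => weighted_negpart2 (t - theta)).
  move=> t; apply: (@continuous_comp _ _ _ (fun t => t - theta) weighted_negpart2).
    by apply: continuousB; [exact: cvg_id|exact: cvg_cst].
  exact: continuous_weighted_negpart2.
have i1 := continuous_itvoo_integrable 0 T continuous_weighted_negpart2.
have i2 := continuous_itvoo_integrable 0 T cs.
apply: fine_le.
- exact: (integrable_fin_num _ i2).
- exact: (integrable_fin_num _ i1).
pose F (t : R) : R := t - theta.
have dF : derive1 F = cst (1 : R).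
  apply/funext => t; rewrite derive1E.
  have := is_deriveB (is_derive_id t 1) (is_derive_cst theta t 1).
  by rewrite subr0 => -[].
have cF : continuous F by move=> t; apply: continuousB; [exact: cvg_id|exact: cvg_cst].
have E : (\int[leb]_(t in `[(F 0%R), (F T)]) (weighted_negpart2 t)%:E =
    \int[leb]_(t in `[0%R, T]) (weighted_negpart2 (t - theta))%:E)%E.
  rewrite (integration_by_substitution_increasing (F := F) (a := 0) (b := T))//.
  - by apply: eq_integral => t _; rewrite dF /= mulr1.
  - exact: ltW.
  - by move=> x y _ _ xy; rewrite /F ltrD2r.
  - by rewrite dF => x _; exact: cvg_cst.
  - by rewrite dF; apply: is_cvg_cst.
  - by rewrite dF; apply: is_cvg_cst.
  - split.
    + move=> x _; have := is_deriveB (is_derive_id x 1) (is_derive_cst theta x 1).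
      by case.
    + by apply: cvg_at_right_filter; exact: cF.
    + by apply: cvg_at_left_filter; exact: cF.
  - by apply: continuous_subspaceT; exact: continuous_weighted_negpart2.
have mw D : measurable_fun D (EFin \o weighted_negpart2).
  apply/measurable_EFinP; apply: measurable_funTS.
  exact: continuous_measurable_fun continuous_weighted_negpart2.
apply: (@le_trans _ _ (\int[leb]_(t in `[0%R, T]) (weighted_negpart2 (t - theta))%:E)%E).
  apply: ge0_subset_integral => //.
  - apply/measurable_EFinP; apply: measurable_funTS.
    exact: continuous_measurable_fun.
  - by move=> t _; rewrite lee_fin weighted_negpart2_ge0.
  - by apply: subset_itv; rewrite bnd_simp.
rewrite -E [leLHS]integral_mkcond [leRHS]integral_mkcond.
apply: ge0_le_integral => //.
- by move=> t _; rewrite patchE; case: ifP => // _; rewrite lee_fin weighted_negpart2_ge0.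
- by apply/(measurable_restrictT _ _).1 => //; exact: mw.
- by apply/(measurable_restrictT _ _).1 => //; exact: mw.
move=> t _; rewrite !patchE.
case: ifPn => [|_]; last by case: ifP => // _; rewrite lee_fin weighted_negpart2_ge0.
rewrite inE/= in_itv/= /F => /andP[_ tT].
case: ifPn => // /negP; rewrite inE/= in_itv/= => h.
rewrite lee_fin /weighted_negpart2 clamp_negpart_le0 ?expr0n ?mulr0//.
rewrite leNgt; apply/negP => t0; apply: h; rewrite t0/=; lra.
Qed.

(** By [negpart_convex] the integrand on the right is at least
    (w t - exp (- lam theta) w (t - theta)) / 2 with w = [weighted_negpart2]; the
    exponential factor comes from the weight, which is not shifted. *)
Lemma caputo_step (theta : R) : 0 < theta ->
  (1 - expR (- (lam * theta))) / 2 * \int[leb]_(t in `]0, T[) weighted_negpart2 t <=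
  \int[leb]_(t in `]0, T[)
    (expR (- (lam * t)) * clamp_negpart t * (vc (t - theta) - vc t)).
Proof.
move=> th0.
have cs : continuous (fun t => weighted_negpart2 (t - theta)).
  move=> t; apply: (@continuous_comp _ _ _ (fun t => t - theta) weighted_negpart2).
    by apply: continuousB; [exact: cvg_id|exact: cvg_cst].
  exact: continuous_weighted_negpart2.
have cvs : continuous (fun t => vc (t - theta)).
  move=> t; apply: (@continuous_comp _ _ _ (fun t => t - theta) vc).
    by apply: continuousB; [exact: cvg_id|exact: cvg_cst].
  exact: C1_itv_continuous_comp.
have i1 := continuous_itvoo_integrable 0 T continuous_weighted_negpart2.
have i2 := continuous_itvoo_integrable 0 T cs.
have i3 : leb.-integrable `]0, T[ (EFin \o (fun t => expR (- (lam * t)) * clamp_negpart t *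
    (vc (t - theta) - vc t))).
  apply: continuous_itvoo_integrable => t.
  apply: (@continuousM _ _ (fun t => expR (- (lam * t)) * clamp_negpart t)
    (fun t => vc (t - theta) - vc t)).
    apply: (@continuousM _ _ (fun t => expR (- (lam * t))) clamp_negpart).
      exact: continuous_weight.
    exact: continuous_clamp_negpart.
  by apply: continuousB; [exact: cvs|exact: C1_itv_continuous_comp].
have pw (t : R) : 2^-1 * weighted_negpart2 t -
      expR (- (lam * theta)) / 2 * weighted_negpart2 (t - theta) <=
    expR (- (lam * t)) * clamp_negpart t * (vc (t - theta) - vc t).
  have -> : expR (- (lam * theta)) / 2 * weighted_negpart2 (t - theta) =
     expR (- (lam * t)) * (clamp_negpart (t - theta) ^+ 2 / 2).
    rewrite /weighted_negpart2 (_ : - (lam * t) = - (lam * theta) + - (lam * (t - theta))); last ring.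
    by rewrite expRD; ring.
  rewrite /weighted_negpart2 mulrCA -mulrBr -mulrA ler_wpM2l ?expR_ge0//.
  have := negpart_convex (vc t + a) (vc (t - theta) + a).
  by rewrite -/(clamp_negpart t) -/(clamp_negpart (t - theta)); lra.
have h := weighted_negpart2_shift_le th0.
apply: (@le_trans _ _ (\int[leb]_(t in `]0, T[)
    (2^-1 * weighted_negpart2 t -
     expR (- (lam * theta)) / 2 * weighted_negpart2 (t - theta)))).
  rewrite RintegralB//; last 2 first.
    by apply: integrable_scaler.
    exact: integrable_scaler i2.
  rewrite !RintegralZl//.
  have : 0 <= expR (- (lam * theta)) by exact: expR_ge0.
  by move: h; set I1 := \int[leb]_(t in _) _; set I2 := \int[leb]_(t in _) _; nra.
apply: le_Rintegral => //.
  apply: integrable_subr => //.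
    exact: integrable_scaler.
  exact: integrable_scaler i2.
Qed.

End caputo_step.

(** * The Caputo derivative of a C^1 function *)

Lemma measurable_set_ltr (R : realType) d (X : measurableType d) (f g : X -> R) :
  measurable_fun setT f -> measurable_fun setT g ->
  measurable [set z | f z < g z].
Proof.
move=> mf mg.
rewrite (_ : [set z | _] = setT `&` (fun z => g z - f z) @^-1` `]0, +oo[).
  by apply: measurable_funB.
by rewrite setTI; apply/seteqP; split => z /=; rewrite in_itv/= andbT subr_gt0.
Qed.

Section caputo_C1.
Variables (R : realType) (alpha T : R) (v : R -> R).
Hypotheses (alpha01 : 0 < alpha < 1) (T0 : 0 < T) (C1v : C1_itv T v).
Local Notation leb := (@lebesgue_measure R).

Lemma C1_itv_derive_measurable : measurable_fun `]0, T[ (derive1 v).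
Proof.
have [_ [_ [dv cdv dvE]]] := C1v.
apply: (@eq_measurable_fun _ _ _ _ _ dv); first by move=> t /[!inE] tT; rewrite dvE.
apply: (@measurable_funS _ _ _ _ `[0, T]%classic) => //.
  by apply: subset_itv; rewrite bnd_simp.
exact: subspace_continuous_measurable_fun.
Qed.

Lemma C1_itv_derive_bounded :
  exists2 L, 0 <= L & forall t, 0 < t < T -> `|derive1 v t| <= L.
Proof.
have [_ [_ [dv cdv dvE]]] := C1v.
have [C C0 h] := compact_continuous_bounded (segment_compact (a := 0) (b := T)) cdv.
exists C => // t tT; rewrite dvE ?in_itv//; apply: h.
by case/andP : tT => t0 tT; rewrite /= in_itv/= !ltW.
Qed.

Lemma C1_itv_FTC r t : 0 <= r -> r < t -> t <= T ->
  (\int[leb]_(s in `]r, t[) (derive1 v s)%:E = (v t - v r)%:E)%E.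
Proof.
move=> r0 rt tT; have [cv [dv [v' cv' v'E]]] := C1v.
have sub : `[r, t] `<=` `[0, T] by apply: subset_itv; rewrite bnd_simp.
have subo x : x \in `]r, t[ -> x \in `]0, T[.
  by rewrite !in_itv/= => /andP[? ?]; apply/andP; split; lra.
have cvrt : {within `[r, t], continuous v} := continuous_subspaceW sub cv.
have [_ cr ct] := (continuous_within_itvP v rt).1 cvrt.
have mv' : measurable_fun `[r, t] (EFin \o v').
  apply/measurable_EFinP; apply: subspace_continuous_measurable_fun => //.
  exact: continuous_subspaceW cv'.
have E : (\int[leb]_(s in `]r, t[) (derive1 v s)%:E =
    \int[leb]_(s in `]r, t[) (v' s)%:E)%E.
  by apply: eq_integral => s /[!inE] /subo /v'E ->.
rewrite E integral_itv_bndo_bndc; last first.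
  by apply: (measurable_funS _ _ mv') => //; apply: subset_itv; rewrite bnd_simp.
rewrite integral_itv_obnd_cbnd; last first.
  by apply: (measurable_funS _ _ mv') => //; apply: subset_itv; rewrite bnd_simp.
rewrite (continuous_FTC2 (F := v))//.
- exact: continuous_subspaceW cv'.
- by split => // x /subo; exact: dv.
- by move=> x /subo; exact: v'E.
Qed.

Definition triangle : set (measurableTypeR R * measurableTypeR R) :=
  [set z | 0 < z.2 /\ z.2 < z.1 /\ z.1 < T].

Lemma measurable_triangle : measurable triangle.
Proof.
pose p1 (z : measurableTypeR R * measurableTypeR R) : R := z.1.
pose p2 (z : measurableTypeR R * measurableTypeR R) : R := z.2.
have m1 : measurable_fun setT p1 by exact: measurable_fst.
have m2 : measurable_fun setT p2 by exact: measurable_snd.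
rewrite (_ : triangle = [set z | cst 0 z < p2 z] `&`
    ([set z | p2 z < p1 z] `&` [set z | p1 z < cst T z]))//.
by apply: measurableI; [|apply: measurableI]; exact: measurable_set_ltr.
Qed.

(** The kernel and the derivative are extended by zero, so that integrals over
    triangles become integrals over the plane and Fubini applies as it stands. *)
Definition caputo_kernel (z : measurableTypeR R * measurableTypeR R) : R :=
  \1_triangle z * ((z.1 - z.2) `^ (- alpha)).

Definition derive_restrict : R -> R := (derive1 v) \_ `]0, T[.

Lemma measurable_derive_restrict : measurable_fun setT derive_restrict.
Proof.
apply/(measurable_restrictT _ _).1 => //; exact: C1_itv_derive_measurable.
Qed.

Lemma measurable_caputo_kernel : measurable_fun setT caputo_kernel.
Proof.
apply: measurable_funM; first by apply: measurable_indic; exact: measurable_triangle.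
apply: (measurableT_comp (measurable_powR (- alpha))).
by apply: measurable_funB; [exact: measurable_fst|exact: measurable_snd].
Qed.

Lemma caputo_kernel_ge0 z : 0 <= caputo_kernel z.
Proof. by rewrite mulr_ge0 ?powR_ge0. Qed.

Lemma triangle_section t s : 0 < t < T -> (triangle (t, s)) = (`]0, t[%classic s).
Proof.
move=> /andP[t0 tT]; rewrite /triangle/= in_itv/=; apply/propext; split.
  by move=> [-> [-> _]].
by move=> /andP[-> ->].
Qed.

(** The bound is uniform in t, which gives both the boundedness of the Caputo
    derivative and the integrability over the plane. *)
Lemma caputo_kernel_section_le t :
  (\int[leb]_s (caputo_kernel (t, s))%:E <=
   ((T `^ (1 - alpha) / (1 - alpha)) * \1_(`]0, T[%classic) t)%:E)%E.
Proof.
have [tT|tT] := boolP (0 < t < T); last first.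
  rewrite indicE memNset ?mulr0; last by rewrite /= in_itv/=; exact/negP.
  rewrite integral0_eq// => s _; rewrite /caputo_kernel indicE memNset ?mul0r//=.
  by move=> [/= s0 [st tT']]; move/negP: tT; apply; rewrite tT' andbT (lt_trans s0).
rewrite indicE mem_set ?mulr1; last by rewrite /= in_itv.
have -> : (\int[leb]_s (caputo_kernel (t, s))%:E =
    \int[leb]_(s in `]0%R, t[) ((t - s) `^ (- alpha))%:E)%E.
  rewrite [RHS]integral_mkcond; apply: eq_integral => s _.
  rewrite patchE /caputo_kernel indicE.
  rewrite (_ : ((t, s) \in triangle) = (s \in `]0, t[%classic)); last first.
    by apply/idP/idP; rewrite !inE triangle_section.
  by case: ifP => _; rewrite ?mul1r ?mul0r.
case/andP : tT => t0 tT.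
apply: le_trans (integral_powR_subr alpha01 t0) _; rewrite lee_fin.
by apply: powR_primitive_le => //; exact: ltW.
Qed.

Lemma integrable_caputo_kernelM (q h : R -> R) (M L : R) :
  measurable_fun setT q -> measurable_fun setT h ->
  (forall t, 0 < t < T -> `|q t| <= M) -> (forall s, 0 < s < T -> `|h s| <= L) ->
  (leb \x leb)%E.-integrable setT (fun z => (caputo_kernel z * (q z.1 * h z.2))%:E).
Proof.
move=> mq mh qM hL.
have mf : measurable_fun setT (fun z : measurableTypeR R * measurableTypeR R =>
    caputo_kernel z * (q z.1 * h z.2)).
  apply: measurable_funM; first exact: measurable_caputo_kernel.
  apply: measurable_funM.
    exact: (measurableT_comp mq (@measurable_fst _ _ _ _)).
  exact: (measurableT_comp mh (@measurable_snd _ _ _ _)).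
apply/integrable12ltyP; first exact/measurable_EFinP.
have T2 : 0 < T / 2 < T by have := T0; lra.
have M0 : 0 <= M by apply: le_trans (qM _ T2).
have L0 : 0 <= L by apply: le_trans (hL _ T2).
have bnd z : `|caputo_kernel z * (q z.1 * h z.2)| <= M * L * caputo_kernel z.
  rewrite normrM ger0_norm ?caputo_kernel_ge0// mulrC.
  have [zt|zt] := pselect (triangle z); last first.
    by rewrite /caputo_kernel indicE memNset// !mul0r !mulr0.
  rewrite ler_wpM2r ?caputo_kernel_ge0// normrM.
  move: zt => [z0 [z12 zT]]; rewrite ler_pM//.
    by apply: qM; rewrite zT andbT (lt_trans z0).
  by apply: hL; rewrite z0/= (lt_trans z12).
have mk t : measurable_fun setT (fun s : R => caputo_kernel (t, s)).
  exact: (measurableT_comp measurable_caputo_kernel (pair1_measurable t)).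
pose C := M * L * (T `^ (1 - alpha) / (1 - alpha)).
have C0 : 0 <= C by apply: mulr_ge0; [exact: mulr_ge0|exact: powR_primitive_ge0].
apply: (@le_lt_trans _ _ (\int[leb]_t (C * \1_(`]0, T[%classic) t)%:E)%E).
  apply: ge0_le_integral => //.
  - by move=> t _; apply: integral_ge0.
  - apply: (measurable_fun_fubini_tonelli_F
      (fun z : measurableTypeR R * measurableTypeR R =>
         `|(caputo_kernel z * (q z.1 * h z.2))%:E|%E)) => //.
    by apply/measurable_EFinP; apply: measurableT_comp.
  - by apply/measurable_EFinP; apply: measurable_funM => //; exact: measurable_indic.
  move=> t _.
  apply: (@le_trans _ _ (\int[leb]_s ((M * L)%:E * (caputo_kernel (t, s))%:E))%E).
    apply: ge0_le_integral => //.
    - apply/measurable_EFinP; apply: measurableT_comp => //.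
      exact: (measurableT_comp mf (pair1_measurable t)).
    - by apply: emeasurable_funM => //; apply/measurable_EFinP; exact: mk.
    - by move=> s _; rewrite -EFinM lee_fin; exact: (bnd (t, s)).
  rewrite ge0_integralZl//.
  - have -> : (C * \1_(`]0, T[%classic) t)%:E = ((M * L)%:E *
        ((T `^ (1 - alpha) / (1 - alpha)) * \1_(`]0, T[%classic) t)%:E)%E.
      by rewrite -EFinM /C !mulrA.
    by apply: lee_wpmul2l; rewrite ?lee_fin ?mulr_ge0//; exact: caputo_kernel_section_le.
  - by apply/measurable_EFinP; exact: mk.
  - by move=> s _; rewrite lee_fin caputo_kernel_ge0.
  - by rewrite lee_fin mulr_ge0.
under eq_integral do rewrite EFinM.
rewrite ge0_integralZl//.
- rewrite integral_indic//= setIT; rewrite lebesgue_measure_itv/= lte_fin T0 oppr0 adde0.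
  by rewrite -EFinM ltry.
- by apply/measurable_EFinP; exact: measurable_indic.
Qed.

Lemma integrable_caputo_kernel_derive :
  (leb \x leb)%E.-integrable setT (fun z => (caputo_kernel z * derive_restrict z.2)%:E).
Proof.
have [L L0 dvL] := C1_itv_derive_bounded.
have := @integrable_caputo_kernelM (fun=> 1) derive_restrict 1 L.
under [X in integrable _ _ X]eq_fun do rewrite mul1r.
apply => //; first exact: measurable_derive_restrict.
  by move=> t _; rewrite normr1.
by move=> s sT; rewrite /derive_restrict patchE mem_set ?dvL// /= in_itv.
Qed.

Lemma caputo_kernel_section_norm_le t L : 0 <= L ->
  (forall s, 0 < s < T -> `|derive1 v s| <= L) ->
  (\int[leb]_s `|(caputo_kernel (t, s) * derive_restrict s)%:E| <=
   (L * ((T `^ (1 - alpha) / (1 - alpha)) * \1_(`]0, T[%classic) t))%:E)%E.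
Proof.
move=> L0 dvL.
have mk : measurable_fun setT (fun s : R => caputo_kernel (t, s)).
  exact: (measurableT_comp measurable_caputo_kernel (pair1_measurable t)).
apply: (@le_trans _ _ (\int[leb]_s (L%:E * (caputo_kernel (t, s))%:E))%E).
  apply: ge0_le_integral => //.
  - apply/measurable_EFinP; apply: measurableT_comp => //.
    by apply: measurable_funM => //; exact: measurable_derive_restrict.
  - by apply: emeasurable_funM => //; apply/measurable_EFinP; exact: mk.
  - move=> s _; rewrite -EFinM lee_fin normrM (ger0_norm (caputo_kernel_ge0 _)) mulrC.
    rewrite ler_wpM2r ?caputo_kernel_ge0// /derive_restrict patchE; case: ifPn => [|_].
      by rewrite inE/= in_itv/=; exact: dvL.
    by rewrite normr0.
rewrite ge0_integralZl//.
- by rewrite EFinM; apply: lee_wpmul2l => //; exact: caputo_kernel_section_le.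
- by apply/measurable_EFinP; exact: mk.
- by move=> s _; rewrite lee_fin caputo_kernel_ge0.
Qed.

Lemma integrable_caputo_kernel_section t :
  leb.-integrable setT (fun s => (caputo_kernel (t, s) * derive_restrict s)%:E).
Proof.
have [L L0 dvL] := C1_itv_derive_bounded.
apply/integrableP; split.
  apply/measurable_EFinP; apply: measurable_funM; last exact: measurable_derive_restrict.
  exact: (measurableT_comp measurable_caputo_kernel (pair1_measurable t)).
by apply: le_lt_trans (caputo_kernel_section_norm_le t L0 dvL) _; rewrite ltry.
Qed.

Lemma caputo_kernelE t : 0 < t < T ->
  caputo alpha v t = (Gamma (1 - alpha))^-1 *
    fine (\int[leb]_s (caputo_kernel (t, s) * derive_restrict s)%:E)%E.
Proof.
move=> tT; rewrite /caputo; congr (_ * _); rewrite /Rintegral; congr fine.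
rewrite integral_mkcond; apply: eq_integral => s _.
rewrite patchE /caputo_kernel indicE.
rewrite (_ : ((t, s) \in triangle) = (s \in `]0, t[%classic)); last first.
  by apply/idP/idP; rewrite !inE triangle_section.
case: ifPn => [|_]; last by rewrite !mul0r.
rewrite mul1r inE/= in_itv/= => /andP[s0 st].
rewrite /derive_restrict patchE mem_set//= in_itv/= s0/=.
by case/andP : tT => _; exact: lt_trans.
Qed.

Lemma caputo_measurable : measurable_fun `]0, T[ (caputo alpha v).
Proof.
apply: (@eq_measurable_fun _ _ _ _ _ (fun t => (Gamma (1 - alpha))^-1 *
    fine (\int[leb]_s (caputo_kernel (t, s) * derive_restrict s)%:E)%E)).
  by move=> t /[!inE]/=; rewrite in_itv/= => tT; rewrite caputo_kernelE.
apply: measurable_funTS; apply: measurable_funM => //.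
apply: (measurableT_comp (f := fine)) => //.
exact: (measurable_fubini_F integrable_caputo_kernel_derive).
Qed.

Lemma caputo_bounded : exists C, forall t, 0 < t < T -> `|caputo alpha v t| <= C.
Proof.
have [L L0 dvL] := C1_itv_derive_bounded.
exists ((Gamma (1 - alpha))^-1 * (L * (T `^ (1 - alpha) / (1 - alpha)))).
move=> t tT; rewrite caputo_kernelE// normrM.
have G0 := Gamma_gt0 alpha01.
rewrite ger0_norm ?invr_ge0 ?(ltW G0)// ler_pM2l ?invr_gt0//.
have ick := integrable_caputo_kernel_section t.
rewrite -[X in X <= _]/(`|\int[leb]_s (caputo_kernel (t, s) * derive_restrict s)|).
rewrite -lee_fin EFin_normr_Rintegral//.
apply: (le_trans (le_abse_integral _ _ _)) => //.
  exact: (measurable_int _ ick).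
apply: le_trans (caputo_kernel_section_norm_le t L0 dvL) _.
by rewrite lee_fin indicE mem_set ?mulr1//= in_itv.
Qed.

End caputo_C1.

(** * The lower bound for C^1 functions *)

(** This locates the lags at which the kernel exceeds a level y: those shorter
    than y^(- 1 / alpha). *)
Lemma lt_powRN_inv (R : realType) (alpha y s : R) : 0 < alpha -> 0 < y -> 0 < s ->
  (y < s `^ (- alpha)) = (s < y^-1 `^ alpha^-1).
Proof.
move=> a0 y0 s0.
have sE : (s `^ alpha) `^ alpha^-1 = s.
  by rewrite -powRrM mulfV ?gt_eqF// powRr1// ltW.
have yE : (y^-1 `^ alpha^-1) `^ alpha = y^-1.
  by rewrite -powRrM mulVf ?gt_eqF// powRr1// invr_ge0 ltW.
rewrite powRN -[y in LHS]invrK ltf_pV2 ?posrE ?invr_gt0 ?powR_gt0//.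
apply/idP/idP => h.
  by rewrite -sE; apply: gt0_ltr_powR; rewrite ?invr_gt0 ?nnegrE ?powR_ge0 ?invr_ge0 ?(ltW y0).
by rewrite -[ltRHS]yE; apply: gt0_ltr_powR; rewrite ?nnegrE ?powR_ge0 ?(ltW s0).
Qed.

Section lebesgue_plane.
Variable R : realType.
Local Notation leb := (@lebesgue_measure R).

(** A named copy of the product measure, to which a sigma-finite structure can be
    attached: the level variable is a third coordinate, and Fubini is used
    between it and the plane. *)
Definition lebesgue_plane : set (measurableTypeR R * measurableTypeR R) -> \bar R :=
  (leb \x leb)%E.

HB.instance Definition _ := Measure.on lebesgue_plane.

Let lebesgue_plane_sigma_finite : sigma_finite setT lebesgue_plane.
Proof.
have /sigma_finiteP[F [TF ndF Foo]] := sigma_finiteT leb.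
exists (fun n => F n `*` F n).
  rewrite -setXTT {1}TF predeqE => -[x y]; split.
    rewrite TF => -[/= [n _ Fnx] [k _ Fky]]; exists (maxn n k) => //; split.
    - by move: x Fnx; exact/subsetPset/ndF/leq_maxl.
    - by move: y Fky; exact/subsetPset/ndF/leq_maxr.
  by move=> [n _ [/= ? ?]]; split => //; exists n.
move=> k; have [mF Fk] := Foo k; split; first exact: measurableX.
rewrite /lebesgue_plane product_measure1E// lte_mul_pinfty// ge0_fin_numE//.
Qed.

HB.instance Definition _ := Measure_isSigmaFinite.Build _ _ _ lebesgue_plane
  lebesgue_plane_sigma_finite.

End lebesgue_plane.

Section caputo_main.
Variables (R : realType) (alpha T lam delta a : R) (v : R -> R).
Hypotheses (alpha01 : 0 < alpha < 1) (T0 : 0 < T) (C1v : C1_itv T v).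
Hypotheses (v00 : v 0 = 0) (a_ge0 : 0 <= a) (lam0 : 0 < lam) (delta0 : 0 < delta).
Local Notation leb := (@lebesgue_measure R).
Local Notation ker := (caputo_kernel alpha T).
Local Notation dv0 := (derive_restrict T v).

Let vc := v \o clamp T.
Let p := clamp_negpart T a v.
Let q (t : R) := expR (- (lam * t)) * p t.
Let G := \int[leb]_(t in `]0, T[) weighted_negpart2 T lam a v t.
Let H (z : measurableTypeR R * measurableTypeR R) : R := q z.1 * - dv0 z.2.

Let cq : continuous q.
Proof.
move=> t; apply: (@continuousM _ _ (fun t => expR (- (lam * t))) p).
  exact: continuous_weight.
exact: continuous_clamp_negpart.
Qed.

Let mq : measurable_fun setT q. Proof. exact: continuous_measurable_fun. Qed.

Let mh : measurable_fun setT (fun s => - dv0 s).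
Proof. by apply: measurableT_comp => //; exact: measurable_derive_restrict. Qed.

Let qM : exists M, forall t, 0 < t < T -> `|q t| <= M.
Proof.
have cqw : {within `[0, T], continuous q} by exact: continuous_subspaceT.
have [C _ h] := compact_continuous_bounded (segment_compact (a := 0) (b := T)) cqw.
by exists C => t /andP[t0 tT]; apply: h; rewrite /= in_itv/= !ltW.
Qed.

Let hL : exists L, forall t, 0 < t < T -> `|- dv0 t| <= L.
Proof.
have [L _ dvL] := C1_itv_derive_bounded C1v.
by exists L => t tT; rewrite normrN /derive_restrict patchE mem_set ?dvL// /= in_itv.
Qed.

Let mH : measurable_fun setT H.
Proof.
apply: measurable_funM.
  exact: (measurableT_comp mq (@measurable_fst _ _ _ _)).
exact: (measurableT_comp mh (@measurable_snd _ _ _ _)).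
Qed.

Let i2 : (leb \x leb)%E.-integrable setT (fun z => (ker z * H z)%:E).
Proof.
have [M hM] := qM; have [L hL'] := hL.
exact: (integrable_caputo_kernelM alpha01 T0 mq mh hM hL').
Qed.

(** The subgraph of the kernel over the plane; the first coordinate is the
    level. *)
Let E : set (measurableTypeR R * (measurableTypeR R * measurableTypeR R)) :=
  [set w | 0 < w.1 /\ w.1 < ker w.2].

Let mE : measurable E.
Proof.
have m1 : measurable_fun setT (fun w : measurableTypeR R *
   (measurableTypeR R * measurableTypeR R) => w.1 : R) by exact: measurable_fst.
have m2 : measurable_fun setT (fun w : measurableTypeR R *
   (measurableTypeR R * measurableTypeR R) => ker w.2).
  exact: (measurableT_comp (measurable_caputo_kernel _ _) (@measurable_snd _ _ _ _)).
rewrite (_ : E = [set w | cst 0 w < w.1] `&` [set w | w.1 < ker w.2])//.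
by apply: measurableI; exact: measurable_set_ltr.
Qed.

Let lfun (w : measurableTypeR R * (measurableTypeR R * measurableTypeR R)) : R :=
  \1_E w * H w.2.

Let mlfun : measurable_fun setT lfun.
Proof.
apply: measurable_funM; first exact: measurable_indic.
exact: (measurableT_comp mH (@measurable_snd _ _ _ _)).
Qed.

Let E_section z : (fun y => \1_E (y, z) : R) = \1_(`]0, ker z[%classic).
Proof.
apply/funext => y; rewrite !indicE; congr (_%:R).
congr nat_of_bool; apply/idP/idP; rewrite !inE /E/= in_itv/=.
  by move=> [-> ->].
by move=> /andP[-> ->].
Qed.

Let leb_section z : leb `]0, ker z[%classic = (ker z)%:E.
Proof.
rewrite lebesgue_measure_itv/= lte_fin; case: ltP => h; first by rewrite oppr0 adde0.
by congr EFin; apply/esym/eqP; rewrite eq_le h caputo_kernel_ge0.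
Qed.

(** The layer-cake formula: the levels below the kernel have its value as measure. *)
Let layer (r : R) z :
  (\int[leb]_y (\1_E (y, z) * r)%:E = (ker z * r)%:E)%E.
Proof.
under eq_integral do rewrite mulrC EFinM.
rewrite integralZl//.
  have -> : (\int[leb]_y (\1_E (y, z))%:E = \int[leb]_y (\1_(`]0%R, ker z[%classic) y)%:E)%E.
    by apply: eq_integral => y _; rewrite -E_section.
  rewrite integral_indic//= setIT; rewrite leb_section.
  by rewrite -EFinM mulrC.
have := integrable_indic_itv 0 (ker z) false true.
by rewrite -E_section.
Qed.

Let i3 : (leb \x @lebesgue_plane R)%E.-integrable setT (EFin \o lfun).
Proof.
apply/integrable21ltyP; first exact/measurable_EFinP.
have /integrableP[_] := i2; apply: le_lt_trans.
apply: ge0_le_integral => //.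
- by move=> z _; apply: integral_ge0.
- apply: (measurable_fun_fubini_tonelli_G (abse \o (EFin \o lfun))) => //.
    by apply: measurableT_comp => //; exact/measurable_EFinP.
  by move=> z; exact: abse_ge0.
- apply/measurable_EFinP; apply: measurableT_comp => //.
  by apply: measurable_funM => //; exact: measurable_caputo_kernel.
move=> z _ /=.
rewrite normrM (ger0_norm (caputo_kernel_ge0 _ _ _)) -layer.
by under eq_integral do rewrite /lfun /= normrM ger0_norm//.
Qed.

(** The contribution of one level; by [level_inner] it is the integral of the
    weighted backward difference of lag y^(- 1 / alpha). *)
Let level (y : R) := (\int[@lebesgue_plane R]_z (lfun (y, z))%:E)%E.

Let i3y y : (leb \x leb)%E.-integrable setT (fun z => (lfun (y, z))%:E).
Proof.
have [M hM] := qM; have [L hL'] := hL.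
have T2 : 0 < T / 2 < T by have := T0; lra.
have M0 : 0 <= M by apply: le_trans (hM _ T2).
have L0 : 0 <= L by apply: le_trans (hL' _ T2).
pose Q : set (measurableTypeR R * measurableTypeR R) := `]0, T[%classic `*` `]0, T[%classic.
have mQ : measurable Q by exact: measurableX.
have iQ : (leb \x leb)%E.-integrable setT (fun z => (M * L * \1_Q z)%:E).
  under eq_fun do rewrite EFinM.
  apply: integrableZl => //; apply/integrableP; split.
    by apply/measurable_EFinP; exact: measurable_indic.
  under eq_integral do rewrite /= ger0_norm//.
  rewrite integral_indic//= setIT product_measure1E//.
  rewrite /= !lebesgue_measure_itv/= lte_fin T0 oppr0 adde0 -EFinM ltry//.
apply: le_integrable iQ => //.
  apply/measurable_EFinP; exact: (measurableT_comp mlfun (pair1_measurable y)).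
move=> z _ /=; rewrite lee_fin (ger0_norm (_ : 0 <= M * L * \1_Q z)); last first.
  by rewrite !mulr_ge0.
rewrite /lfun normrM ger0_norm//=.
have [Ez|Ez] := pselect (E (y, z)); last first.
  by rewrite indicE memNset// mul0r !mulr_ge0.
have zt : triangle T z.
  case: Ez => y0 yz; apply: contrapT => nz; move: (lt_trans y0 yz).
  by rewrite /= /caputo_kernel indicE memNset// mul0r ltxx.
rewrite indicE mem_set// mul1r indicE mem_set ?mulr1; last first.
  case: zt => z0 [z12 zT]; split; rewrite /= in_itv/=.
    by rewrite zT (lt_trans z0).
  by rewrite z0 (lt_trans z12).
rewrite normrM; case: zt => z0 [z12 zT]; apply: ler_pM => //.
  by apply: hM; rewrite zT (lt_trans z0).
by apply: hL'; rewrite z0 (lt_trans z12).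
Qed.

Let level_le0 y : y <= 0 -> level y = 0%E.
Proof.
move=> y0; rewrite /level integral0_eq// => z _.
rewrite /lfun indicE memNset ?mul0r//=.
by move=> [/= h _]; move: h; rewrite ltNge y0.
Qed.

(** At level y the variable s runs over the interval from max (t - theta) 0 to t,
    on which the derivative of v integrates to a difference of values of the
    clamped function. *)
Let level_inner y t : 0 < y -> 0 < t < T ->
  (\int[leb]_s (lfun (y, (t, s)))%:E =
   (q t * (vc (t - y^-1 `^ alpha^-1) - vc t))%:E)%E.
Proof.
move=> y0 /andP[t0 tT]; set theta := y^-1 `^ alpha^-1.
have th0 : 0 < theta by rewrite powR_gt0// invr_gt0.
have al0 : 0 < alpha by case/andP : alpha01.
pose r := Num.max (t - theta) 0.
have r0 : 0 <= r by rewrite le_max lexx orbT.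
have rt : r < t by rewrite gt_max t0 andbT ltrBlDr ltrDl.
have -> : (\int[leb]_s (lfun (y, (t, s)))%:E =
    \int[leb]_(s in `]r, t[) ((- q t)%:E * (derive1 v s)%:E))%E.
  rewrite [RHS]integral_mkcond; apply: eq_integral => s _.
  rewrite patchE /lfun /H /= indicE.
  rewrite (_ : ((y, (t, s)) \in E) = (s \in `]r, t[%classic)); last first.
    apply/idP/idP; rewrite !inE /E/= in_itv/=.
      move=> [_ yk].
      have zt : triangle T (t, s).
        apply: contrapT => nz; move: (lt_trans y0 yk).
        by rewrite /caputo_kernel indicE memNset// mul0r ltxx.
      case: (zt) => /= s0 [st _]; rewrite st andbT gt_max s0 andbT.
      move: yk; rewrite /caputo_kernel indicE mem_set// mul1r/= lt_powRN_inv//; last by lra.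
      by rewrite -/theta; lra.
    rewrite gt_max => /andP[/andP[h1 s0] st]; split => //.
    rewrite /caputo_kernel indicE mem_set//= mul1r lt_powRN_inv//; last by lra.
    by rewrite -/theta; lra.
  case: ifPn => [|_]; last by rewrite mul0r.
  rewrite inE/= in_itv/= => /andP[rs st].
  rewrite mul1r /derive_restrict patchE mem_set; last first.
    by rewrite /= in_itv/= (le_lt_trans r0 rs) (lt_trans st).
  by rewrite -EFinM mulrN mulNr.
have sub s : `]r, t[%classic s -> `]0, T[%classic s.
  rewrite /= !in_itv/= => /andP[rs st].
  by rewrite (le_lt_trans r0 rs) (lt_trans st).
have iv : leb.-integrable `]r, t[ (fun s => (derive1 v s)%:E).
  have [L L0 dvL] := C1_itv_derive_bounded C1v.
  apply: measurable_bounded_integrable => //.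
  - rewrite /= lebesgue_measure_itv/=; case: ifP => _; rewrite ?ltry//.
  - exact: (measurable_funS _ sub (C1_itv_derive_measurable C1v)).
  - exists L; split; first exact: num_real.
    move=> K LK s /sub; rewrite /= in_itv/= => /dvL h; exact: le_trans h (ltW LK).
rewrite integralZl// (C1_itv_FTC C1v r0 rt (ltW tT)) -EFinM; congr EFin.
rewrite /vc /= (@clamp_id _ _ t) ?(ltW t0) ?(ltW tT)//.
have -> : clamp T (t - theta) = r.
  rewrite /clamp -/r min_l//; apply: ltW; exact: lt_trans tT.
by rewrite mulNr -mulrN opprB.
Qed.

Let level_gt0 y : 0 < y ->
  (((1 - expR (- (lam * (y^-1 `^ alpha^-1)))) / 2 * G)%:E <= level y)%E.
Proof.
move=> y0; set theta := y^-1 `^ alpha^-1.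
have th0 : 0 < theta by rewrite powR_gt0// invr_gt0.
have -> : level y = (\int[leb]_t \int[leb]_s (lfun (y, (t, s)))%:E)%E.
  exact: (esym (integral12_prod_meas1 (i3y y))).
have -> : (\int[leb]_t \int[leb]_s (lfun (y, (t, s)))%:E =
    \int[leb]_(t in `]0%R, T[) (q t * (vc (t - theta) - vc t))%:E)%E.
  rewrite [RHS]integral_mkcond; apply: eq_integral => t _; rewrite patchE.
  case: ifPn => [|tT].
    by rewrite inE/= in_itv/=; exact: level_inner.
  rewrite integral0_eq// => s _; rewrite /lfun indicE memNset ?mul0r//=.
  move=> [_ /=]; rewrite /caputo_kernel indicE memNset ?mul0r; first by lra.
  move=> [/= s0 [st tT']]; move/negP: tT; apply; rewrite inE/= in_itv/= tT' andbT.
  exact: lt_trans st.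
have cvs : continuous (fun t => vc (t - theta)).
  move=> t; apply: (@continuous_comp _ _ _ (fun t => t - theta) vc).
    by apply: continuousB; [exact: cvg_id|exact: cvg_cst].
  exact: C1_itv_continuous_comp.
have i4 : leb.-integrable `]0, T[ (EFin \o (fun t => q t * (vc (t - theta) - vc t))).
  apply: continuous_itvoo_integrable => t.
  apply: (@continuousM _ _ q (fun t => vc (t - theta) - vc t)); first exact: cq.
  by apply: continuousB; [exact: cvs|exact: C1_itv_continuous_comp].
rewrite -[leRHS]fineK; last exact: (integrable_fin_num _ i4).
rewrite lee_fin; by apply: caputo_step.
Qed.

(** By Fubini the right side is the integral over all levels divided by
    Gamma (1 - alpha).  Every level contributes a nonnegative amount, and those in
    ]0, delta^(- alpha)[ have a lag larger than delta, hence contribute at least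
    (1 - exp (- lam delta)) / 2 times the weighted integral. *)
Lemma caputo_C1_lower_bound :
  (Gamma (1 - alpha))^-1 * delta `^ (- alpha) * ((1 - expR (- (lam * delta))) / 2) *
    \int[leb]_(t in `]0, T[) weighted_negpart2 T lam a v t <=
  \int[leb]_(t in `]0, T[)
    (expR (- (lam * t)) * clamp_negpart T a v t * - caputo alpha v t).
Proof.
have al0 : 0 < alpha by case/andP : alpha01.
have G0 : 0 < Gamma (1 - alpha) by exact: Gamma_gt0.
have Gge0 : 0 <= G by apply: Rintegral_ge0 => t _; exact: weighted_negpart2_ge0.
pose c := (1 - expR (- (lam * delta))) / 2 * G.
have c0 : 0 <= c.
  rewrite mulr_ge0// divr_ge0// subr_ge0 -expR0 ler_expR oppr_le0 mulr_ge0//; exact: ltW.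
have level_ge (y : R) : ((c * \1_(`]0, delta `^ (- alpha)[%classic) y)%:E <= level y)%E.
  have [y0|y0] := leP y 0.
    rewrite level_le0// indicE memNset ?mulr0//=.
    by rewrite in_itv/= ltNge y0.
  apply: le_trans (level_gt0 y0); rewrite lee_fin indicE.
  case: (boolP (y \in _)) => [|_]; last first.
    rewrite mulr0 mulr_ge0// divr_ge0// subr_ge0 -expR0 ler_expR oppr_le0 mulr_ge0 ?(ltW lam0)// powR_ge0//.
  rewrite inE/= in_itv/= => /andP[_ yd]; rewrite mulr1 /c ler_wpM2r//.
  rewrite ler_pM2r ?invr_gt0// lerD2l lerN2 ler_expR lerN2 ler_pM2l//.
  by apply: ltW; rewrite -lt_powRN_inv.
have J1 : (\int[leb]_y level y = \int[leb]_(t in `]0%R, T[)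
    (q t * - (Gamma (1 - alpha) * caputo alpha v t))%:E)%E.
  transitivity (\int[@lebesgue_plane R]_z \int[leb]_y (lfun (y, z))%:E)%E.
    exact: (Fubini i3).
  transitivity (\int[(leb \x leb)%E]_z (ker z * H z)%:E)%E.
    by apply: eq_integral => z _; rewrite -layer.
  transitivity (\int[leb]_t \int[leb]_s (ker (t, s) * H (t, s))%:E)%E.
    exact: (esym (integral12_prod_meas1 i2)).
  rewrite [RHS]integral_mkcond.
  apply: eq_integral => t _; rewrite patchE /fubini_F.
  case: ifPn => [|tT].
    rewrite inE/= in_itv/= => tT.
    have ick := integrable_caputo_kernel_section alpha01 C1v t.
    rewrite (caputo_kernelE alpha v tT) mulVKf ?gt_eqF//.
    have HE s : ker (t, s) * H (t, s) = - q t * (ker (t, s) * dv0 s).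
      by rewrite /H /=; ring.
    under eq_integral do rewrite HE EFinM.
    rewrite integralZl// -[X in (_ * X)%E]fineK; last exact: integrable_fin_num.
    by rewrite -EFinM mulNr mulrN.
  rewrite integral0_eq// => s _; rewrite /caputo_kernel indicE memNset ?mul0r//=.
  move=> [/= s0 [st tT']]; move/negP: tT; apply; rewrite inE/= in_itv/= tT' andbT.
  exact: lt_trans st.
have J2 : ((delta `^ (- alpha) * c)%:E <= \int[leb]_y level y)%E.
  have -> : ((delta `^ (- alpha) * c)%:E =
      \int[leb]_y (c * \1_(`]0%R, delta `^ (- alpha)[%classic) y)%:E)%E.
    under eq_integral do rewrite EFinM.
    rewrite ge0_integralZl//.
    - rewrite integral_indic//= setIT; rewrite lebesgue_measure_itv/= lte_fin powR_gt0//.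
      by rewrite oppr0 adde0 -EFinM mulrC.
    - by apply/measurable_EFinP; exact: measurable_indic.
  apply: ge0_le_integral => //.
  - by move=> y _; rewrite lee_fin mulr_ge0.
  - by apply/measurable_EFinP; apply: measurable_funM => //; exact: measurable_indic.
  - exact: (measurable_fubini_F i3).
rewrite J1 in J2.
have [C hC] := caputo_bounded alpha01 C1v.
have [M hM] := qM.
have ic : leb.-integrable `]0, T[ (EFin \o (fun t => q t * - caputo alpha v t)).
  apply: measurable_bounded_integrable => //.
  - by rewrite /= lebesgue_measure_itv/=; case: ifP => _; rewrite ?ltry.
  - apply: measurable_funM; first exact: measurable_funTS.
    by apply: measurableT_comp => //; exact: caputo_measurable.
  - exists (M * C); split; first exact: num_real.
    move=> K MK t; rewrite /= in_itv/= => tT; rewrite normrM normrN.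
    by apply: le_trans (ltW MK); apply: ler_pM => //; [exact: hM|exact: hC].
have J3 : (\int[leb]_(t in `]0%R, T[) (q t * - (Gamma (1 - alpha) * caputo alpha v t))%:E
    = (Gamma (1 - alpha) * \int[leb]_(t in `]0, T[) (q t * - caputo alpha v t))%:E)%E.
  rewrite EFinM [X in (_ * X)%E]fineK; last exact: integrable_fin_num.
  rewrite -integralZl//; apply: eq_integral => t _.
  by rewrite -EFinM; congr EFin; ring.
rewrite J3 lee_fin in J2.
rewrite -(ler_pdivrMl _ _ G0) in J2; apply: le_trans J2.
by rewrite /c /G !mulrA.
Qed.

End caputo_main.

(** * The lower bound for the extended derivative *)

Section caputo_ext_bound.
Variables (R : realType) (alpha T lam delta a : R) (v w : R -> R).
Hypotheses (alpha01 : 0 < alpha < 1) (T0 : 0 < T).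
Hypotheses (a_ge0 : 0 <= a) (lam0 : 0 < lam) (delta0 : 0 < delta).
Hypothesis vw : caputo_ext alpha T v w.
Local Notation leb := (@lebesgue_measure R).
Local Notation I := (`]0, T[%classic : set (measurableTypeR R)).

(** Both sides of the bound for C^1 functions are continuous for the convergence
    in L^2 of the functions and of their Caputo derivatives, the negative part
    being Lipschitz and the weight bounded. *)
Lemma caputo_ext_lower_bound :
  leb.-integrable I
    (fun t => (expR (- (lam * t)) * negpart (v t + a) * - w t)%:E) /\
  (Gamma (1 - alpha))^-1 * delta `^ (- alpha) * ((1 - expR (- (lam * delta))) / 2) *
    \int[leb]_(t in I) (expR (- (lam * t)) * negpart (v t + a) * negpart (v t + a)) <=
  \int[leb]_(t in I) (expR (- (lam * t)) * negpart (v t + a) * - w t).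
Proof.
have mI : measurable I by [].
have [[L2v _] L2w [vk [C1vk [cvk _] cwk]]] := vw.
have Lv := L2_sqintegrable mI L2v; have Lw := L2_sqintegrable mI L2w.
have cv := L2_cvg_sqcvg cvk; have cw := L2_cvg_sqcvg cwk.
have Ioo : (leb I < +oo)%E.
  by rewrite /= lebesgue_measure_itv/=; case: ifP => _; rewrite ?ltry.
have LC (f : R -> R) : {within `[0, T], continuous f} -> sqintegrable leb I f.
  move=> cf.
  have [C _ h] := compact_continuous_bounded (segment_compact (a := 0) (b := T)) cf.
  apply: (@sqintegrable_bounded _ _ _ leb I _ C) => //.
    apply: (@measurable_funS _ _ _ _ `[0, T]%classic) => //.
      by apply: subset_itv; rewrite bnd_simp.
    exact: subspace_continuous_measurable_fun.
  move=> t; rewrite /= in_itv/= => /andP[t0 tT]; apply: h.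
  by rewrite /= in_itv/= !ltW.
have Lvk k : sqintegrable leb I (vk k) by apply: LC; have [[]] := C1vk k.
have Lcst (r : R) : sqintegrable leb I (fun=> r).
  by apply: LC; apply: continuous_subspaceT => x; exact: cvg_cst.
have Lneg (f : R -> R) : sqintegrable leb I f ->
    sqintegrable leb I (fun t => negpart (f t + a)).
  move=> Lf; have Lfa := sqintegrableD mI Lf (Lcst a).
  apply: sqintegrable_le (Lfa) => //.
    by apply: measurable_negpart; case: Lfa.
  by move=> x _; exact: negpart_le_norm.
have mW : measurable_fun I (fun t => expR (- (lam * t))).
  apply: measurable_funTS; apply: continuous_measurable_fun; exact: continuous_weight.
have W1 t : I t -> `|expR (- (lam * t))| <= 1.
  rewrite /= in_itv/= => /andP[t0 _]; rewrite ger0_norm ?expR_ge0//.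
  by rewrite -expR0 ler_expR oppr_le0 mulr_ge0// ltW.
have LW (f : R -> R) : sqintegrable leb I f ->
    sqintegrable leb I (fun t => expR (- (lam * t)) * f t).
  by move=> Lf; apply: (sqintegrableM (C := 1)).
split; first exact: (sqintegrable_mul mI (LW _ (Lneg _ Lv)) (sqintegrableN mI Lw)).
have cneg : sqcvg leb I (fun k t => negpart (vk k t + a)) (fun t => negpart (v t + a)).
  apply: (@sqcvg_le _ _ _ leb I vk v _ _ 1) => //.
  - by move=> k; case: (Lvk k).
  - by case: Lv.
  - by move=> k; case: (Lneg _ (Lvk k)).
  - by case: (Lneg _ Lv).
  - move=> k t _; rewrite mul1r; apply: le_trans (negpart_lip _ _) _.
    by rewrite opprD addrACA subrr addr0.
have cWneg : sqcvg leb I (fun k t => expR (- (lam * t)) * negpart (vk k t + a))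
    (fun t => expR (- (lam * t)) * negpart (v t + a)).
  apply: (@sqcvg_le _ _ _ leb I (fun k t => negpart (vk k t + a))
    (fun t => negpart (v t + a)) _ _ 1) => //.
  - by move=> k; case: (Lneg _ (Lvk k)).
  - by case: (Lneg _ Lv).
  - by move=> k; case: (LW _ (Lneg _ (Lvk k))).
  - by case: (LW _ (Lneg _ Lv)).
  - by move=> k t It; rewrite -mulrBr normrM ler_wpM2r//; exact: W1.
have Lcap k : sqintegrable leb I (fun t => - caputo alpha (vk k) t).
  have [C1 _] := C1vk k; have [C hC] := caputo_bounded alpha01 C1.
  apply: sqintegrableN => //; apply: (@sqintegrable_bounded _ _ _ leb I _ C) => //.
    exact: caputo_measurable.
have ccap : sqcvg leb I (fun k t => - caputo alpha (vk k) t) (fun t => - w t).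
  apply: (@sqcvg_le _ _ _ leb I (fun k => caputo alpha (vk k)) w _ _ 1) => //.
  - by move=> k; apply: caputo_measurable => //; case: (C1vk k).
  - by case: Lw.
  - by move=> k; case: (Lcap k).
  - by case: (sqintegrableN mI Lw).
  - by move=> k t _; rewrite mul1r -opprD normrN.
have lim1 := cvg_Rintegral_mul mI (fun k => LW _ (Lneg _ (Lvk k))) (LW _ (Lneg _ Lv)) cWneg
  (fun k => Lneg _ (Lvk k)) (Lneg _ Lv) cneg.
have lim2 := cvg_Rintegral_mul mI (fun k => LW _ (Lneg _ (Lvk k))) (LW _ (Lneg _ Lv)) cWneg
  Lcap (sqintegrableN mI Lw) ccap.
set kap := (X in X * _ <= _).
have key k : kap * \int[leb]_(t in I)
      (expR (- (lam * t)) * negpart (vk k t + a) * negpart (vk k t + a)) <=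
    \int[leb]_(t in I) (expR (- (lam * t)) * negpart (vk k t + a) * - caputo alpha (vk k) t).
  have [C1 vk0] := C1vk k.
  have := caputo_C1_lower_bound alpha01 T0 C1 vk0 a_ge0 lam0 delta0.
  rewrite -/kap => h; apply: le_trans (le_trans _ h) _.
    rewrite le_eqVlt; apply/orP; left; apply/eqP; congr (_ * _); apply: eq_Rintegral => t.
    rewrite inE/= in_itv/= => /andP[t0 tT].
    by rewrite /weighted_negpart2 /clamp_negpart clamp_id ?(ltW t0) ?(ltW tT)// expr2 mulrA.
  rewrite le_eqVlt; apply/orP; left; apply/eqP; apply: eq_Rintegral => t.
  rewrite inE/= in_itv/= => /andP[t0 tT].
  by rewrite /clamp_negpart clamp_id ?(ltW t0) ?(ltW tT).
have lim3 : kap * \int[leb]_(t in I)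
      (expR (- (lam * t)) * negpart (vk k t + a) * negpart (vk k t + a))
    @[k --> \oo] --> kap * \int[leb]_(t in I)
      (expR (- (lam * t)) * negpart (v t + a) * negpart (v t + a)).
  by apply: cvgM; [exact: cvg_cst|exact: lim1].
rewrite -(cvg_lim _ lim3)// -(cvg_lim _ lim2)//.
by apply: ler_lim; [apply/cvg_ex; eexists; exact: lim3|apply/cvg_ex; eexists; exact: lim2|apply: nearW].
Qed.

End caputo_ext_bound.

(** * Integrals over rectangles and their sections *)

Section product_sections.
Context d1 d2 (X : measurableType d1) (Y : measurableType d2) (R : realType).
Variables (m1 : {sigma_finite_measure set X -> \bar R})
          (m2 : {sigma_finite_measure set Y -> \bar R}).
Implicit Types (A : set X) (B : set Y).

Lemma integral_ae_ge0 d (Z : measurableType d) (mu : {measure set Z -> \bar R})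
    (D : set Z) (f : Z -> \bar R) : measurable D -> measurable_fun D f ->
  {ae mu, forall x, D x -> (0 <= f x)%E} -> (0 <= \int[mu]_(x in D) f x)%E.
Proof.
move=> mD mf f0; rewrite integralE.
rewrite [X in (_ - X)%E](_ : _ = 0%E) ?sube0; first by apply: integral_ge0.
rewrite (ae_eq_integral (cst 0%E))//.
- by rewrite integral0.
- exact: measurable_funeneg.
- by apply: filterS f0 => x h Dx; rewrite funenegE (max_idPr _)// oppe_le0 h.
Qed.

(** A measurable null set N covers the exceptional points; by Tonelli almost all
    its sections are null. *)
Lemma ae_section1 (P : X * Y -> Prop) : {ae (m1 \x m2)%E, forall z, P z} ->
  {ae m1, forall x, {ae m2, forall y, P (x, y)}}.
Proof.
move=> [N [mN N0 PN]].
have mx := measurable_fun_xsection m2 mN.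
have : {ae m1, forall x, [set: X] x -> m2 (xsection N x) = 0%E}.
  apply/(ae_eq_integral_abs m1 measurableT mx).
  by under eq_integral do rewrite gee0_abs//.
apply: filterS => x /(_ I) Nx0; exists (xsection N x); split => //.
  exact: measurable_xsection.
by move=> y nP; rewrite /xsection/= inE; exact: PN.
Qed.

Section rectangle.
Variables (A : set X) (B : set Y) (mA : measurable A) (mB : measurable B).

Let restrict_section (f : X * Y -> \bar R) x y :
  (f \_ (A `*` B)) (x, y) = ((fun x => ((fun y => f (x, y)) \_ B) y) \_ A) x.
Proof.
rewrite !patchE; case: ifPn => [|/negP h].
  by rewrite inE => -[/= Ax By]; rewrite !mem_set.
case: ifPn => // /set_mem Ax; case: ifPn => // /set_mem By.
by exfalso; apply: h; rewrite inE.
Qed.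

Variable f : X * Y -> \bar R.
Hypothesis fi : (m1 \x m2)%E.-integrable (A `*` B) f.

Let fiT : (m1 \x m2)%E.-integrable setT (f \_ (A `*` B)).
Proof.
have h := @integrable_mkcond _ _ _ (m1 \x m2)%E (A `*` B) f (measurableX mA mB).
exact: (h.1 fi).
Qed.

Let secY x : A x -> (fun y => (f \_ (A `*` B)) (x, y)) = (fun y => f (x, y)) \_ B.
Proof. by move=> Ax; apply/funext => y; rewrite restrict_section patchE mem_set. Qed.

Let secX y : B y -> (fun x => (f \_ (A `*` B)) (x, y)) = (fun x => f (x, y)) \_ A.
Proof.
by move=> By; apply/funext => x; rewrite restrict_section !patchE (mem_set By).
Qed.

Lemma integrable_section1 :
  {ae m1, forall x, A x -> m2.-integrable B (fun y => f (x, y))}.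
Proof.
apply: filterS (ae_integrable1 fiT) => x h Ax.
by apply/integrable_mkcond => //; rewrite -secY.
Qed.

Lemma integrable_section2 :
  {ae m2, forall y, B y -> m1.-integrable A (fun x => f (x, y))}.
Proof.
apply: filterS (ae_integrable2 fiT) => y h By.
by apply/integrable_mkcond => //; rewrite -secX.
Qed.

Lemma measurable_integral_section1 :
  measurable_fun A (fun x => \int[m2]_(y in B) f (x, y))%E.
Proof.
have := measurable_funTS (measurable_fubini_F fiT).
move=> /(_ A); apply: eq_measurable_fun => x /set_mem Ax.
by rewrite /fubini_F [RHS]integral_mkcond secY.
Qed.

Lemma measurable_integral_section2 :
  measurable_fun B (fun y => \int[m1]_(x in A) f (x, y))%E.
Proof.
have := measurable_funTS (measurable_fubini_G fiT).
move=> /(_ B); apply: eq_measurable_fun => y /set_mem By.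
by rewrite /fubini_G [RHS]integral_mkcond secX.
Qed.

Lemma integral_setX1 : (\int[(m1 \x m2)%E]_(z in A `*` B) f z =
  \int[m1]_(x in A) \int[m2]_(y in B) f (x, y))%E.
Proof.
rewrite integral_mkcond -(integral12_prod_meas1 fiT) [RHS]integral_mkcond.
apply: eq_integral => x _; rewrite patchE /fubini_F; case: ifPn => [/set_mem Ax|Ax].
  by rewrite [RHS]integral_mkcond secY.
by apply: integral0_eq => y _; rewrite restrict_section patchE (negbTE Ax).
Qed.

Lemma integral_setX2 : (\int[(m1 \x m2)%E]_(z in A `*` B) f z =
  \int[m2]_(y in B) \int[m1]_(x in A) f (x, y))%E.
Proof.
rewrite integral_mkcond -(integral21_prod_meas1 fiT) [RHS]integral_mkcond.
apply: eq_integral => y _; rewrite patchE /fubini_G; case: ifPn => [/set_mem By|By].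
  by rewrite [RHS]integral_mkcond secX.
apply: integral0_eq => x _; rewrite restrict_section !patchE (negbTE By).
by case: ifP.
Qed.

End rectangle.

Lemma measurable_section2 (A : set X) (B : set Y) (f : X * Y -> R) y :
  measurable A -> measurable B -> measurable_fun (A `*` B) f -> B y ->
  measurable_fun A (fun x => f (x, y)).
Proof.
move=> mA mB mf By.
have mfT : measurable_fun setT (f \_ (A `*` B)).
  by apply/(measurable_restrictT _ _).1 => //; exact: measurableX.
have := measurable_funTS (measurableT_comp mfT (pair2_measurable y)).
move=> /(_ A); apply: eq_measurable_fun => x /set_mem Ax /=.
by rewrite patchE mem_set.
Qed.

Lemma sqintegrable_section2 (A : set X) (B : set Y) (f : X * Y -> R) :
  measurable A -> measurable B -> sqintegrable (m1 \x m2)%E (A `*` B) f ->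
  {ae m2, forall y, B y -> sqintegrable m1 A (fun x => f (x, y))}.
Proof.
move=> mA mB [mf if2]; apply: filterS (integrable_section2 mA mB if2) => y h By.
by split; [exact: measurable_section2 mf By|exact: h].
Qed.

End product_sections.

(** * Nonnegativity *)

Lemma negpart_mul (R : realType) (y : R) : negpart y * y = - (negpart y) ^+ 2.
Proof. by rewrite /negpart; case: leP => h; ring. Qed.

Lemma ae_and (R : realType) d (X : measurableType d)
    (mu : {measure set X -> \bar R}) (P Q : X -> Prop) :
  {ae mu, forall x, P x} -> {ae mu, forall x, Q x} ->
  {ae mu, forall x, P x /\ Q x}.
Proof. exact: filterI. Qed.

Lemma ae_imply (R : realType) d (X : measurableType d)
    (mu : {measure set X -> \bar R}) (P Q : X -> Prop) :
  {ae mu, forall x, P x} -> (forall x, P x -> Q x) -> {ae mu, forall x, Q x}.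
Proof. by move=> aeP PQ; exact: filterS aeP. Qed.

(** With lam = 1 / delta the last factor is a positive constant, while
    delta^(- alpha) is unbounded as delta goes to 0. *)
Lemma exists_large_rate (R : realType) (alpha C : R) : 0 < alpha < 1 ->
  exists lam delta : R, [/\ 0 < lam, 0 < delta &
   C < (Gamma (1 - alpha))^-1 * delta `^ (- alpha) * ((1 - expR (- (lam * delta))) / 2)].
Proof.
move=> alpha01; have G0 := Gamma_gt0 alpha01; have /andP[al0 _] := alpha01.
have e1 : 0 < (1 - expR (- 1 : R)) / 2.
  by rewrite divr_gt0// subr_gt0 -[ltRHS]expR0 ltr_expR; lra.
(* B is the value of delta^(- alpha) for which the rate equals |C| + 1 *)
pose B := Gamma (1 - alpha) * ((`|C| + 1) / ((1 - expR (- 1)) / 2)).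
have C1 : 0 < `|C| + 1 by rewrite ltr_wpDl.
have B0 : 0 < B by rewrite mulr_gt0// divr_gt0.
pose delta := B `^ (- alpha^-1).
have d0 : 0 < delta by rewrite powR_gt0.
exists delta^-1, delta; split => //; first by rewrite invr_gt0.
rewrite mulVf ?gt_eqF// /delta -powRrM mulrNN mulVf ?gt_eqF// powRr1 ?(ltW B0)//.
rewrite /B mulKf ?gt_eqF// divfK ?gt_eqF//.
by rewrite (le_lt_trans (ler_norm _))// ltrDl.
Qed.

Section weighted_estimates.
Variables (R : realType) (n : nat) (T lam : R) (Omega : set 'rV[R]_n).
Variables (u : 'rV[R]_n * R -> R) (P : 'I_n -> 'I_n -> 'rV[R]_n * R -> R).
Local Notation leb := (@lebesgue_measure R).
Local Notation lebn := (lebesgue_rV R n).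
Local Notation m := (lebn \x leb)%E.
Local Notation J := (`]0, T[%classic : set (measurableTypeR R)).
Local Notation Q := (Omega `*` J).
Hypotheses (T0 : 0 < T) (lam0 : 0 < lam).
Hypotheses (oO : open Omega) (bO : bounded_set Omega).
Hypotheses (Lu : sqintegrable m Q u) (LP : forall i j, sqintegrable m Q (P i j)).

Let S z := \sum_i \sum_j P i j z.
Let p z := negpart (u z).
Let W (z : 'rV[R]_n * measurableTypeR R) : R := expR (- (lam * z.2)).

Let mO : measurable Omega. Proof. exact: open_measurable_rV. Qed.
Let mJ : measurable J. Proof. exact: measurable_itv. Qed.
Let mQ : measurable Q. Proof. exact: measurableX. Qed.

Let LWp : sqintegrable m Q (fun z => W z * p z).
Proof.
apply: (sqintegrableM (C := 1)) => //.
- apply: measurable_funTS.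
  apply: (@measurableT_comp _ _ _ _ _ _ (fun t => expR (- (lam * t)))).
    by apply: continuous_measurable_fun; exact: continuous_weight.
  exact: measurable_snd.
- move=> -[x t] [/= _]; rewrite in_itv/= => /andP[t0 _].
  by rewrite ger0_norm ?expR_ge0// -expR0 ler_expR oppr_le0 mulr_ge0// ltW.
- apply: sqintegrable_le (Lu) => //; first by apply: measurable_negpart; case: Lu.
  by move=> z _; exact: negpart_le_norm.
Qed.

Lemma integrable_weighted_negpartS : m.-integrable Q (EFin \o (fun z => W z * p z * S z)).
Proof.
apply: sqintegrable_mul => //.
by apply: sqintegrable_sum => // i; exact: sqintegrable_sum.
Qed.
Let iS := integrable_weighted_negpartS.

Lemma integrable_weighted_negpart2 : m.-integrable Q (EFin \o (fun z => W z * p z * p z)).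
Proof.
apply: sqintegrable_mul => //.
apply: sqintegrable_le (Lu) => //; first by apply: measurable_negpart; case: Lu.
by move=> z _; exact: negpart_le_norm.
Qed.
Let ip := integrable_weighted_negpart2.

(** At almost every time the section of the integrand is, up to the factor
    exp (- lam t), the one of [elliptic_negpart]. *)
Lemma weighted_elliptic_negpart (A : 'I_n -> 'I_n -> 'rV[R]_n -> R)
    (Du : 'I_n -> 'rV[R]_n * R -> R) :
  (forall i j, C0_closure Omega (A i j)) ->
  (forall x, Omega x -> forall xi : 'I_n -> R,
    0 <= \sum_i \sum_j A i j x * xi i * xi j) ->
  {ae leb, forall t, J t ->
    H1_0 Omega (fun x => u (x, t)) (fun i x => Du i (x, t)) /\
    forall i j, weak_partial Omega i (fun x => A i j x * Du j (x, t))
                                     (fun x => P i j (x, t))} ->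
  0 <= \int[m]_(z in Q) (W z * p z * S z).
Proof.
move=> cA A_ge0 eqt; apply: fine_ge0; rewrite (integral_setX2 mO mJ iS).
apply: integral_ae_ge0 => //; first exact: (measurable_integral_section2 mO mJ iS).
have aeP : {ae leb, forall t, J t ->
    forall i j, sqintegrable lebn Omega (fun x => P i j (x, t))}.
  have : {ae leb, forall t, forall i j, J t ->
      sqintegrable lebn Omega (fun x => P i j (x, t))}.
    apply: filter_forall => i; apply: filter_forall => j.
    exact: (sqintegrable_section2 mO mJ (LP i j)).
  by apply: filterS => t h Jt i j; exact: h.
apply: (ae_imply (ae_and (ae_and eqt aeP) (integrable_section2 mO mJ iS))).
move=> t [[h1 h2] h3] Jt; have [H1 wP] := h1 Jt.
have h4 := elliptic_negpart oO bO cA A_ge0 H1 (h2 Jt) wP.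
have iSt : lebn.-integrable Omega (EFin \o (fun x => S (x, t) * negpart (u (x, t)))).
  have := integrable_scaler (expR (lam * t)) mO (h3 Jt).
  apply: eq_integrable => // x _ /=; congr EFin.
  by rewrite /W /= !mulrA -expRD subrr expR0 mul1r mulrC.
rewrite -[leRHS]fineK; last exact: (integrable_fin_num _ (h3 Jt)).
rewrite lee_fin.
have -> : fine (\int[lebn]_(x in Omega) (W (x, t) * p (x, t) * S (x, t))%:E)%E =
    expR (- (lam * t)) * \int[lebn]_(x in Omega) (S (x, t) * negpart (u (x, t))).
  rewrite -RintegralZl//; apply: eq_Rintegral => x _.
  by rewrite -mulrA [p _ * _]mulrC.
by rewrite mulr_ge0 ?expR_ge0.
Qed.

(** For almost every x the time bound is applied to u (x, .) - a x, whose extended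
    Caputo derivative is S + c u + F.  In p (- (S + c u + F)) the last two terms
    are at most C p^2, because p u = - p^2 and F >= 0. *)
Lemma weighted_caputo_negpart (alpha delta C : R) (c a : 'rV[R]_n -> R)
    (F : 'rV[R]_n * R -> R) : 0 < alpha < 1 -> 0 < delta ->
  (forall x, Omega x -> `|c x| <= C) ->
  {ae lebn, forall x, Omega x -> 0 <= a x} ->
  {ae m, forall z, Q z -> 0 <= F z} ->
  {ae lebn, forall x, Omega x -> caputo_ext alpha T (fun t => u (x, t) - a x)
    (fun t => S (x, t) + c x * u (x, t) + F (x, t))} ->
  (Gamma (1 - alpha))^-1 * delta `^ (- alpha) * ((1 - expR (- (lam * delta))) / 2) *
    \int[m]_(z in Q) (W z * p z * p z) <=
  C * \int[m]_(z in Q) (W z * p z * p z) - \int[m]_(z in Q) (W z * p z * S z).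
Proof.
move=> alpha01 delta0 cC a0 F0 eqx; set kap := (X in X * _ <= _).
pose N z := (C - kap) * (W z * p z * p z) - W z * p z * S z.
have iN : m.-integrable Q (EFin \o N).
  by apply: integrable_subr => //; exact: integrable_scaler.
suff : 0 <= \int[m]_(z in Q) N z.
  rewrite /N RintegralB//; last exact: (integrable_scaler (C - kap) mQ ip).
  by rewrite RintegralZl// mulrBl addrAC subr_ge0.
apply: fine_ge0; rewrite (integral_setX1 mO mJ iN); apply: integral_ae_ge0 => //.
  exact: (measurable_integral_section1 mO mJ iN).
apply: (ae_imply (ae_and (ae_and (ae_and eqx a0) (ae_section1 F0))
  (ae_and (integrable_section1 mO mJ iS) (integrable_section1 mO mJ ip)))).
move=> x [[[e1 e2] e3] [e4 e5]] Ox.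
have capx := e1 Ox; have ax := e2 Ox; have iSx := e4 Ox; have ipx := e5 Ox.
have [iw lb] := caputo_ext_lower_bound alpha01 T0 ax lam0 delta0 capx.
pose w t := S (x, t) + c x * u (x, t) + F (x, t).
have {}iw : leb.-integrable J (EFin \o (fun t => W (x, t) * p (x, t) * - w t)).
  by apply: eq_integrable iw => // t _ /=; rewrite subrK.
have {}lb : kap * \int[leb]_(t in J) (W (x, t) * p (x, t) * p (x, t)) <=
    \int[leb]_(t in J) (W (x, t) * p (x, t) * - w t).
  apply: le_trans (le_trans _ lb) _; rewrite le_eqVlt; apply/orP; left; apply/eqP.
    by congr (_ * _); apply: eq_Rintegral => t _; rewrite subrK.
  by apply: eq_Rintegral => t _; rewrite subrK.
have iC := integrable_scaler C mJ ipx.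
have iCS := integrable_subr mJ iC iSx.
(* h is the deficit in the pointwise inequality - p w <= C p^2 - p S *)
pose h t := C * (W (x, t) * p (x, t) * p (x, t)) - W (x, t) * p (x, t) * S (x, t)
  - W (x, t) * p (x, t) * - w t.
have ih : leb.-integrable J (EFin \o h) by exact: (integrable_subr mJ iCS iw).
have h0 : 0 <= \int[leb]_(t in J) h t.
  apply: fine_ge0; apply: integral_ae_ge0 => //; first exact: (measurable_int _ ih).
  apply: filterS e3 => t Ft Jt; rewrite lee_fin.
  have {}Ft : 0 <= F (x, t) by exact: Ft.
  have -> : h t = W (x, t) * ((C - c x) * p (x, t) ^+ 2 + p (x, t) * F (x, t)).
    have := negpart_mul (u (x, t)); rewrite -/(p (x, t)) => pu.
    rewrite /h /w; transitivity (W (x, t) *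
        (C * p (x, t) ^+ 2 + c x * (p (x, t) * u (x, t)) + p (x, t) * F (x, t))).
      ring.
    by rewrite pu; ring.
  rewrite mulr_ge0 ?expR_ge0// addr_ge0//.
    by rewrite mulr_ge0 ?sqr_ge0// subr_ge0 (le_trans (ler_norm _))// cC.
  by rewrite mulr_ge0// negpart_ge0.
have iNx : leb.-integrable J (EFin \o (fun t => N (x, t))).
  by apply: integrable_subr => //; exact: integrable_scaler.
rewrite -[leRHS]fineK; last exact: (integrable_fin_num _ iNx).
rewrite lee_fin -[fine _]/(\int[leb]_(t in J) N (x, t)).
rewrite /N RintegralB//; last exact: (integrable_scaler (C - kap) mJ ipx).
rewrite RintegralZl// mulrBl addrAC subr_ge0; apply: le_trans lb _.
by move: h0; rewrite /h RintegralB// RintegralB// RintegralZl// subr_ge0.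
Qed.

Lemma nonneg_of_weighted_negpart2 : \int[m]_(z in Q) (W z * p z * p z) <= 0 ->
  {ae m, forall z, Q z -> 0 <= u z}.
Proof.
move=> le0.
have Wpp0 z : 0 <= W z * p z * p z.
  by rewrite -mulrA mulr_ge0 ?expR_ge0// mulr_ge0// negpart_ge0.
have fin := integrable_fin_num mQ ip.
have abs0 : (\int[m]_(z in Q) `|(W z * p z * p z)%:E| = 0)%E.
  under eq_integral do rewrite gee0_abs ?lee_fin ?Wpp0//.
  rewrite -(fineK fin); congr EFin; apply/eqP; rewrite eq_le; apply/andP; split=> //.
  by apply: fine_ge0; apply: integral_ge0 => z _; rewrite lee_fin.
have := (ae_eq_integral_abs m mQ (measurable_int _ ip)).1 abs0.
apply: filterS => z zero Qz; have /= [/eqP] := zero Qz.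
rewrite -mulrA mulf_eq0 gt_eqF ?expR_gt0//= mulf_eq0 orbb => /eqP p0.
by rewrite leNgt; apply/negP => u0; move: p0; rewrite /p /negpart max_l; lra.
Qed.

End weighted_estimates.

Theorem theorem1 (R : realType) (n : nat) (alpha T : R)
  (Omega : set 'rV[R]_n) (A : 'I_n -> 'I_n -> 'rV[R]_n -> R)
  (mu0 : R) (c a : 'rV[R]_n -> R) (F u : 'rV[R]_n * R -> R)
  (hn : (0 < n)%N) (halpha : 0 < alpha < 1) (hT : 0 < T)
  (hOmega : bounded_domain Omega) (hbd : smooth_boundary Omega)
  (hA : forall i j, C1_closure Omega (A i j))
  (hAsym : forall i j x, closure Omega x -> A i j x = A j i x)
  (hmu0 : 0 < mu0)
  (hell : forall x, closure Omega x -> forall xi : 'I_n -> R,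
     mu0 * \sum_i xi i ^+ 2 <= \sum_i \sum_j A i j x * xi i * xi j)
  (hc : C0_closure Omega c)
  (ha : L2 (lebesgue_rV R n) Omega a)
  (hF : L2 (lebesgue_rV R n \x @lebesgue_measure R)%E (cylinder Omega T) F)
  (hu : weak_solution alpha T Omega A c a F u)
  (hF0 : {ae (lebesgue_rV R n \x @lebesgue_measure R)%E,
           forall z, cylinder Omega T z -> 0 <= F z})
  (ha0 : {ae lebesgue_rV R n, forall x, Omega x -> 0 <= a x}) :
  {ae (lebesgue_rV R n \x @lebesgue_measure R)%E,
    forall z, cylinder Omega T z -> 0 <= u z}.
Proof.
have [oO _ _ bO] := hOmega.
have mQ : measurable (Omega `*` `]0, T[%classic : set ('rV[R]_n * measurableTypeR R)).
  by apply: measurableX; [exact: open_measurable_rV|exact: measurable_itv].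
have [Du [D2u [P [[L2u _] LD eqt eqx]]]] := hu.
have Lu := L2_sqintegrable mQ L2u.
have LP i j := L2_sqintegrable mQ ((LD i).2 j).2.
have [C cC] := C0_closure_bounded bO hc.
have [lam [delta [lam0 delta0 kapC]]] := exists_large_rate C halpha.
have A_ge0 x : Omega x -> forall xi : 'I_n -> R,
    0 <= \sum_i \sum_j A i j x * xi i * xi j.
  move=> Ox xi; apply: le_trans (hell x _ xi); last exact: subset_closure.
  by rewrite mulr_ge0 ?(ltW hmu0)// sumr_ge0// => i _; exact: sqr_ge0.
have space := weighted_elliptic_negpart lam0 oO bO Lu LP
  (fun i j => (hA i j).1) A_ge0.
have {}space := space Du (ae_imply eqt
  (fun t h Jt => conj (h Jt).1 (fun i j => ((h Jt).2 i j).2))).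
have time := weighted_caputo_negpart hT lam0 oO Lu LP halpha delta0 cC ha0 hF0
  (ae_imply eqx (fun x h Ox => (h Ox).2)).
rewrite /= in space time.
set kap := (X in C < X) in kapC.
move: space time; set I2 := Rintegral _ _ _; set I1 := Rintegral _ _ _ => space time.
apply: (nonneg_of_weighted_negpart2 lam0 oO Lu); rewrite leNgt; apply/negP => I1_gt0.
have : 0 < (kap - C) * I1 by rewrite mulr_gt0// subr_gt0.
by rewrite mulrBl subr_gt0 ltNge (le_trans time)// gerBl.
Qed.
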